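(* Fix $1 \le p < 2$. There is a constant $c_p > 0$ depending only on $p$ such that the following holds for all integers $n \ge d \ge 1$ and $r \ge 2$. If a distribution over $r \times n$ real matrices $\Pi$ is an $\ell_p$ oblivious subspace embedding for $n\times d$ matrices with distortion $\kappa$, then $$\kappa \;\ge\; \frac{c_p}{\left(\frac{1}{d}\right)^{1/p}\log^{2/p} r \;+\; \left(\frac{r}{n}\right)^{1/p-1/2}}.$$
   Context: For $y\in\mathbb{R}^n$, $\|y\|_p=(\sum_i |y_i|^p)^{1/p}$. A distribution over $r\times n$ real matrices $\Pi$ is an $\ell_p$ oblivious subspace embedding (for $n\times d$ matrices) with distortion $\kappa \ge 1$ if for every fixed $A\in\mathbb{R}^{n\times d}$, $$\Pr_{\Pi}\big[\ \|Ax\|_p \le \|\Pi A x\|_p \le \kappa\|Ax\|_p \text{ for all } x\in\mathbb{R}^d\ \big] \ge 0.99.$$ The distribution may depend on $n,d,r$ but not on $A$. *)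

(* Defs.v *)
From Stdlib Require Import Reals Lra.
Open Scope R_scope.

Fixpoint sumR (n : nat) (f : nat -> R) : R :=
  match n with
  | O => 0
  | S k => sumR k f + f k
  end.

(* real power x^a for x >= 0, with the convention 0^a = 0 (a > 0) *)
Definition rpow (x a : R) : R :=
  if Rle_dec x 0 then 0 else Rpower x a.

Definition lpnorm (p : R) (m : nat) (y : nat -> R) : R :=
  rpow (sumR m (fun i => rpow (Rabs (y i)) p)) (1 / p).

Definition matvec (k : nat) (M : nat -> nat -> R) (x : nat -> R) : nat -> R :=
  fun i => sumR k (fun j => M i j * x j).

Definition sigma_algebra {Omega : Type} (F : (Omega -> Prop) -> Prop) : Prop :=
  F (fun _ => True) /\
  (forall E, F E -> F (fun w => ~ E w)) /\
  (forall E : nat -> Omega -> Prop, (forall k, F (E k)) ->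
     F (fun w => exists k, E k w)).

Definition prob_space {Omega : Type} (F : (Omega -> Prop) -> Prop)
  (P : (Omega -> Prop) -> R) : Prop :=
  sigma_algebra F /\
  (forall E, F E -> 0 <= P E) /\
  P (fun _ => True) = 1 /\
  (forall E : nat -> Omega -> Prop,
     (forall k, F (E k)) ->
     (forall i j w, i <> j -> E i w -> E j w -> False) ->
     infinite_sum (fun k => P (E k)) (P (fun w => exists k, E k w))).

Definition random_matrix {Omega : Type} (F : (Omega -> Prop) -> Prop)
  (r n : nat) (Pi : Omega -> nat -> nat -> R) : Prop :=
  forall i j (a : R), (i < r)%nat -> (j < n)%nat -> F (fun w => Pi w i j <= a).

Definition lp_OSE {Omega : Type} (F : (Omega -> Prop) -> Prop)
  (P : (Omega -> Prop) -> R) (p : R) (n d r : nat)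
  (Pi : Omega -> nat -> nat -> R) (kappa : R) : Prop :=
  1 <= kappa /\
  forall A : nat -> nat -> R,
    exists E : Omega -> Prop, F E /\ P E >= 0.99 /\
      forall w, E w -> forall x : nat -> R,
        lpnorm p n (matvec d A x) <= lpnorm p r (matvec n (Pi w) (matvec d A x))
        /\ lpnorm p r (matvec n (Pi w) (matvec d A x))
           <= kappa * lpnorm p n (matvec d A x).

(* Main.v *)
Require Import Defs.
From Stdlib Require Import Reals Lra Lia List Arith.
From Stdlib Require Import ClassicalEpsilon FunctionalExtensionality PropExtensionality.
Open Scope R_scope.

(* A random test matrix A has one column of random signs on the first N = 2^L
   coordinates, the others being independent sparse vectors: for a uniform scale
   s <= L, cut [N] into 2^s blocks and put a random sign at a random place of each
   block. Averaging fixes one matrix M = Pi w that is good for most A.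

   Lower bound on M: by Jensen, the sign column gives
   N <~ sum_i (sum_j M_ij^2)^(p/2).
   Upper bound on M: all d columns are good simultaneously, so a single sparse
   column is bad with probability O(1/d), hence O(L/d) at each scale s. A column
   of M with p-norm^p above 2 kappa^p 2^s spoils every scale-s vector that meets it
   for one choice of the sign, so there are only O(N 2^-s L/d) of those; summed over s,
   the columns with W_j = ||M e_j||_p^p > 2 kappa^p have total mass
   O(kappa^p N L^2/d). The remaining columns contribute at most
   O(kappa^p N (r/N)^(1-p/2)) by Jensen over the rows. Therefore
   1 <~ kappa^p (L^2/d + (r/N)^(1-p/2)).

   Since injectivity forces d <= r, N may be cut down to a fixed power of r: then
   L = O(log r), while (r/N)^(1-p/2) <= 1/r <= 1/d. *)

(** * Finite sums *)

Lemma sumR_ext n f g : (forall i, (i < n)%nat -> f i = g i) -> sumR n f = sumR n g.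
Proof.
  induction n as [|n IH]; intros H; simpl; [reflexivity|].
  rewrite IH, (H n); auto.
Qed.

Lemma sumR_le n f g : (forall i, (i < n)%nat -> f i <= g i) -> sumR n f <= sumR n g.
Proof.
  induction n as [|n IH]; intros H; simpl; [lra|].
  apply Rplus_le_compat; auto.
Qed.

Lemma sumR_plus n f g : sumR n (fun i => f i + g i) = sumR n f + sumR n g.
Proof. induction n as [|n IH]; simpl; [lra|]. rewrite IH; lra. Qed.

Lemma sumR_scal n c f : sumR n (fun i => c * f i) = c * sumR n f.
Proof. induction n as [|n IH]; simpl; [lra|]. rewrite IH; lra. Qed.

Lemma sumR_const n c : sumR n (fun _ => c) = INR n * c.
Proof. induction n as [|n IH]; [simpl; lra|]. rewrite S_INR; simpl; rewrite IH; lra. Qed.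

Lemma sumR_zero n f : (forall i, (i < n)%nat -> f i = 0) -> sumR n f = 0.
Proof. intros H. rewrite (sumR_ext n f (fun _ => 0) H), sumR_const; lra. Qed.

Lemma sumR_nonneg n f : (forall i, (i < n)%nat -> 0 <= f i) -> 0 <= sumR n f.
Proof.
  intros H. rewrite <- (sumR_zero n (fun _ => 0)) by reflexivity. now apply sumR_le.
Qed.

Lemma sumR_term n f k :
  (forall i, (i < n)%nat -> 0 <= f i) -> (k < n)%nat -> f k <= sumR n f.
Proof.
  induction n as [|n IH]; intros H Hk; [lia|simpl].
  assert (0 <= sumR n f) by (apply sumR_nonneg; auto).
  assert (0 <= f n) by auto.
  destruct (Nat.eq_dec k n) as [->|]; [lra|].
  assert (f k <= sumR n f) by (apply IH; auto; lia). lra.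
Qed.

Lemma sumR_swap n m f :
  sumR n (fun i => sumR m (fun j => f i j)) = sumR m (fun j => sumR n (fun i => f i j)).
Proof.
  induction n as [|n IH]; simpl.
  - symmetry; now apply sumR_zero.
  - now rewrite IH, sumR_plus.
Qed.

Lemma sumR_delta n k f g :
  (k < n)%nat -> (forall i, (i < n)%nat -> i <> k -> f i = 0) -> f k = g -> sumR n f = g.
Proof.
  induction n as [|n IH]; intros Hk H Hg; [lia|simpl].
  destruct (Nat.eq_dec k n) as [->|].
  - rewrite sumR_zero; [lra|]. intros i Hi; apply H; lia.
  - rewrite (IH ltac:(lia)); auto. rewrite (H n); auto; lra.
Qed.

Lemma sumR_app n m f : sumR (n + m) f = sumR n f + sumR m (fun i => f (n + i)%nat).
Proof.
  induction m as [|m IH]; simpl.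
  - rewrite Nat.add_0_r; lra.
  - rewrite Nat.add_succ_r; simpl; rewrite IH; lra.
Qed.

Lemma sumR_extend N n f :
  (N <= n)%nat -> (forall i, (N <= i)%nat -> f i = 0) -> sumR n f = sumR N f.
Proof.
  intros HN H. replace n with (N + (n - N))%nat by lia.
  rewrite sumR_app, (sumR_zero (n - N)); [lra|]. intros; apply H; lia.
Qed.

Lemma sumR_blocks k m f :
  sumR (k * m) f = sumR k (fun b => sumR m (fun t => f (b * m + t)%nat)).
Proof.
  induction k as [|k IH]; simpl; [reflexivity|].
  rewrite Nat.add_comm, sumR_app, IH; reflexivity.
Qed.

(** * Real powers *)

Lemma rpow_Rpower x a : 0 < x -> rpow x a = Rpower x a.
Proof. intros H; unfold rpow; destruct (Rle_dec x 0); [lra|reflexivity]. Qed.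

Lemma rpow_0 x a : x <= 0 -> rpow x a = 0.
Proof. intros H; unfold rpow; destruct (Rle_dec x 0); [reflexivity|lra]. Qed.

Lemma rpow_pos x a : 0 < x -> 0 < rpow x a.
Proof. intros H; rewrite rpow_Rpower by assumption; apply exp_pos. Qed.

Lemma rpow_nonneg x a : 0 <= rpow x a.
Proof.
  destruct (Rle_dec x 0); [rewrite rpow_0; lra|].
  left; apply rpow_pos; lra.
Qed.

Lemma rpow_le x y a : 0 <= a -> x <= y -> rpow x a <= rpow y a.
Proof.
  intros Ha H. destruct (Rle_dec x 0).
  - rewrite rpow_0 by assumption; apply rpow_nonneg.
  - rewrite !rpow_Rpower by lra. apply Rle_Rpower_l; lra.
Qed.

Lemma rpow_rpow x a b : rpow (rpow x a) b = rpow x (a * b).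
Proof.
  destruct (Rle_dec x 0).
  - now rewrite (rpow_0 x), (rpow_0 0), (rpow_0 x) by lra.
  - rewrite (rpow_Rpower (rpow x a)) by (apply rpow_pos; lra).
    rewrite !rpow_Rpower by lra. apply Rpower_mult.
Qed.

Lemma rpow_mult x y a : 0 <= x -> 0 <= y -> rpow (x * y) a = rpow x a * rpow y a.
Proof.
  intros Hx Hy.
  destruct (Req_dec x 0) as [->|]; [rewrite Rmult_0_l, rpow_0; lra|].
  destruct (Req_dec y 0) as [->|]; [rewrite Rmult_0_r, rpow_0; lra|].
  assert (0 < x * y) by (apply Rmult_lt_0_compat; lra).
  rewrite !rpow_Rpower by lra. symmetry; apply Rpower_mult_distr; lra.
Qed.

Lemma rpow_plus x a b : rpow x (a + b) = rpow x a * rpow x b.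
Proof.
  destruct (Rle_dec x 0).
  - rewrite !(rpow_0 x) by assumption; lra.
  - rewrite !rpow_Rpower by lra. apply Rpower_plus.
Qed.

Lemma rpow_1_r x : 0 <= x -> rpow x 1 = x.
Proof.
  intros Hx. destruct (Req_dec x 0) as [->|]; [apply rpow_0; lra|].
  rewrite rpow_Rpower by lra. apply Rpower_1; lra.
Qed.

Lemma rpow_1_l a : rpow 1 a = 1.
Proof. rewrite rpow_Rpower by lra. unfold Rpower; rewrite ln_1, Rmult_0_r; apply exp_0. Qed.

Lemma rpow_inv_cancel x a : 0 <= x -> a <> 0 -> rpow (rpow x (1 / a)) a = x.
Proof.
  intros Hx Ha. rewrite rpow_rpow. replace (1 / a * a) with 1 by (field; assumption).
  now apply rpow_1_r.
Qed.

Lemma rpow_Rinv x a : 0 < x -> rpow (/ x) a = / rpow x a.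
Proof.
  intros Hx. assert (H := rpow_pos x a Hx).
  apply Rmult_eq_reg_l with (rpow x a); [|lra].
  rewrite <- rpow_mult by (try apply Rlt_le, Rinv_0_lt_compat; lra).
  rewrite !Rinv_r, rpow_1_l by lra; reflexivity.
Qed.

Lemma rpow_abs_sqr x p : rpow (Rabs x) p = rpow (x * x) (p / 2).
Proof.
  replace (x * x) with (Rabs x * Rabs x)
    by (rewrite <- Rabs_mult; apply Rabs_pos_eq; nra).
  rewrite rpow_mult by apply Rabs_pos. rewrite <- rpow_plus. f_equal; lra.
Qed.

Lemma exp_tangent x y : exp y * (1 + (x - y)) <= exp x.
Proof.
  replace (exp x) with (exp y * exp (x - y)) by (rewrite <- exp_plus; f_equal; lra).
  apply Rmult_le_compat_l; [left; apply exp_pos|].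
  destruct (Req_dec (x - y) 0) as [->|H]; [rewrite exp_0; lra|].
  left; now apply exp_ineq1.
Qed.

(** The tangent at [q * y], evaluated at [y] and at [0] with weights [q] and [1 - q], gives this
    bound. *)
Lemma exp_convex q y : 0 <= q <= 1 -> exp (q * y) <= (1 - q) + q * exp y.
Proof.
  intros Hq. assert (H1 := exp_tangent y (q * y)). assert (H0 := exp_tangent 0 (q * y)).
  rewrite exp_0 in H0. assert (0 < exp (q * y)) by apply exp_pos.
  apply Rmult_le_compat_l with (r := q) in H1; [|lra].
  apply Rmult_le_compat_l with (r := 1 - q) in H0; [|lra].
  nra.
Qed.

(** The concave function [x^q] lies below its tangent at [m]; averaging this inequality proves
    Jensen. *)
Lemma rpow_tangent x m q : 0 <= q <= 1 -> 0 <= x -> 0 < m ->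
  rpow x q <= (1 - q) * rpow m q + q * (rpow m q / m) * x.
Proof.
  intros Hq Hx Hm. assert (Hp := rpow_pos m q Hm).
  assert (Hd : 0 < rpow m q / m) by (apply Rdiv_lt_0_compat; lra).
  destruct (Req_dec x 0) as [->|].
  { rewrite rpow_0 by lra. nra. }
  replace x with (m * (x / m)) at 1 by (field; lra).
  assert (Hxm : 0 < x / m) by (apply Rdiv_lt_0_compat; lra).
  rewrite rpow_mult by lra.
  assert (H1 : rpow (x / m) q <= (1 - q) + q * (x / m)).
  { rewrite rpow_Rpower by lra. unfold Rpower.
    rewrite <- (exp_ln (x / m)) at 2 by lra. now apply exp_convex. }
  replace ((1 - q) * rpow m q + q * (rpow m q / m) * x)
    with (rpow m q * ((1 - q) + q * (x / m))) by (field; lra).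
  apply Rmult_le_compat_l; lra.
Qed.

Lemma rpow_ge_id u q : 0 <= u <= 1 -> 0 <= q <= 1 -> u <= rpow u q.
Proof.
  intros Hu Hq. rewrite <- (rpow_1_r u) at 1 by lra.
  replace 1 with (q + (1 - q)) at 1 by lra. rewrite rpow_plus.
  assert (H1 := rpow_le u 1 (1 - q) ltac:(lra) ltac:(lra)). rewrite rpow_1_l in H1.
  assert (0 <= rpow u q) by apply rpow_nonneg. nra.
Qed.

(** A share [z / (x + y)] in [0, 1] is at most its [q]-th power; multiply by [(x + y)^q] and add the
    cases [z = x] and [z = y]. *)
Lemma rpow_subadd x y q : 0 <= q <= 1 -> 0 <= x -> 0 <= y ->
  rpow (x + y) q <= rpow x q + rpow y q.
Proof.
  intros Hq Hx Hy. destruct (Req_dec (x + y) 0) as [E|Hs].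
  { rewrite E, rpow_0 by lra.
    assert (H1 := rpow_nonneg x q); assert (H2 := rpow_nonneg y q); lra. }
  assert (F : forall z, 0 <= z <= x + y -> rpow (x + y) q * (z / (x + y)) <= rpow z q).
  { intros z Hz. replace z with ((x + y) * (z / (x + y))) at 2 by (field; lra).
    assert (0 <= z / (x + y)) by (apply Rle_mult_inv_pos; lra).
    assert (z / (x + y) <= 1) by (apply Rmult_le_reg_r with (x + y); [lra|];
      unfold Rdiv; rewrite Rmult_assoc, Rinv_l; lra).
    rewrite rpow_mult by lra. apply Rmult_le_compat_l; [apply rpow_nonneg|].
    apply rpow_ge_id; lra. }
  assert (H1 := F x ltac:(lra)). assert (H2 := F y ltac:(lra)).
  replace (rpow (x + y) q)
    with (rpow (x + y) q * (x / (x + y)) + rpow (x + y) q * (y / (x + y)))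
    by (field; lra).
  lra.
Qed.

Lemma rpow_subadd_sumR n f q : 0 <= q <= 1 -> (forall i, (i < n)%nat -> 0 <= f i) ->
  rpow (sumR n f) q <= sumR n (fun i => rpow (f i) q).
Proof.
  intros Hq. induction n as [|n IH]; intros H; simpl; [rewrite rpow_0; lra|].
  assert (0 <= sumR n f) by (apply sumR_nonneg; auto).
  assert (H1 := rpow_subadd (sumR n f) (f n) q Hq ltac:(assumption) ltac:(auto)).
  assert (H2 := IH ltac:(auto)). lra.
Qed.

(** * Finitely supported distributions *)

(** Distributions of the test data are lists of weighted points, possibly repeated, and [ev] is the
    expectation: every average over them is a finite sum. *)
Fixpoint ev {X : Type} (l : list (R * X)) (f : X -> R) : R :=
  match l with
  | nil => 0
  | (w, x) :: l' => w * f x + ev l' f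
  end.

Definition law {X : Type} (l : list (R * X)) : Prop :=
  Forall (fun wx => 0 <= fst wx) l /\ ev l (fun _ => 1) = 1.

Definition dret {X : Type} (x : X) : list (R * X) := (1, x) :: nil.

Definition dscale {X : Type} (w : R) (l : list (R * X)) : list (R * X) :=
  map (fun vy => (w * fst vy, snd vy)) l.

Fixpoint dbind {X Y : Type} (l : list (R * X)) (k : X -> list (R * Y)) : list (R * Y) :=
  match l with
  | nil => nil
  | (w, x) :: l' => dscale w (k x) ++ dbind l' k
  end.

Section Ev.
Context {X : Type}.
Implicit Types (l : list (R * X)) (f g : X -> R).

Lemma ev_ext l f g : (forall x, f x = g x) -> ev l f = ev l g.
Proof.
  intros H; induction l as [|[w x] l IH]; simpl; [reflexivity|]. now rewrite IH, H.
Qed.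

Lemma ev_plus l f g : ev l (fun x => f x + g x) = ev l f + ev l g.
Proof. induction l as [|[w x] l IH]; simpl; [lra|]. rewrite IH; lra. Qed.

Lemma ev_scal l c f : ev l (fun x => c * f x) = c * ev l f.
Proof. induction l as [|[w x] l IH]; simpl; [lra|]. rewrite IH; lra. Qed.

Lemma ev_const l c : law l -> ev l (fun _ => c) = c.
Proof.
  intros [_ H]. rewrite (ev_ext l (fun _ => c) (fun _ => c * 1)) by (intros; lra).
  rewrite ev_scal, H; lra.
Qed.

Lemma ev_le l f g : law l -> (forall x, f x <= g x) -> ev l f <= ev l g.
Proof.
  intros [H _] Hfg; induction H as [|[w x] l Hw Hl IH]; simpl in *; [lra|].
  assert (w * f x <= w * g x) by (apply Rmult_le_compat_l; auto). lra.
Qed.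

Lemma ev_nonneg l f : law l -> (forall x, 0 <= f x) -> 0 <= ev l f.
Proof.
  intros Hl H. rewrite <- (ev_const l 0 Hl). now apply ev_le.
Qed.

Lemma ev_app l1 l2 f : ev (l1 ++ l2) f = ev l1 f + ev l2 f.
Proof. induction l1 as [|[w x] l IH]; simpl; [lra|]. rewrite IH; lra. Qed.

Lemma ev_dscale w l f : ev (dscale w l) f = w * ev l f.
Proof. induction l as [|[v x] l IH]; simpl; [lra|]. rewrite IH; lra. Qed.

Lemma ev_dret x f : ev (dret x) f = f x.
Proof. simpl; lra. Qed.

Lemma law_dret (x : X) : law (dret x).
Proof. split; [repeat constructor; simpl; lra|simpl; lra]. Qed.

Lemma ev_sumR l n (f : X -> nat -> R) :
  ev l (fun x => sumR n (f x)) = sumR n (fun i => ev l (fun x => f x i)).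
Proof.
  induction n as [|n IH]; simpl.
  - rewrite (ev_ext l (fun _ => 0) (fun _ => 0 * 0)) by (intros; lra).
    rewrite (ev_scal l 0 (fun _ => 0)); lra.
  - rewrite ev_plus, IH; reflexivity.
Qed.

End Ev.

Lemma ev_dbind {X Y : Type} l (k : X -> list (R * Y)) (f : Y -> R) :
  ev (dbind l k) f = ev l (fun x => ev (k x) f).
Proof.
  induction l as [|[w x] l IH]; simpl; [reflexivity|].
  rewrite ev_app, ev_dscale, IH; reflexivity.
Qed.

Lemma law_dbind {X Y : Type} l (k : X -> list (R * Y)) :
  law l -> (forall x, law (k x)) -> law (dbind l k).
Proof.
  intros Hl Hk; split.
  - destruct Hl as [Hl _]; induction Hl as [|[w x] l Hw Hl IH]; simpl; [constructor|].
    apply Forall_app; split; [|exact IH].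
    unfold dscale; apply Forall_map. destruct (Hk x) as [H _].
    apply Forall_impl with (2 := H). intros [v y]; simpl in *; intros.
    now apply Rmult_le_pos.
  - rewrite ev_dbind. transitivity (ev l (fun _ => 1)); [|now apply ev_const].
    apply ev_ext; intros x; now apply ev_const.
Qed.

(** Average the tangent bound taken at the mean; a zero mean has no tangent and is treated apart. *)
Lemma jensen {X : Type} l (f : X -> R) q : law l -> 0 < q < 1 -> (forall x, 0 <= f x) ->
  ev l (fun x => rpow (f x) q) <= rpow (ev l f) q.
Proof.
  intros Hl Hq Hf.
  assert (T : forall m, 0 < m -> ev l (fun x => rpow (f x) q)
                <= (1 - q) * rpow m q + q * (rpow m q / m) * ev l f).
  { intros m Hm.
    apply Rle_trans with (ev l (fun x => (1 - q) * rpow m q + q * (rpow m q / m) * f x)).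
    - apply ev_le; auto. intros x; apply rpow_tangent; auto; lra.
    - rewrite ev_plus, ev_const, ev_scal by assumption; lra. }
  assert (H0 : 0 <= ev l f) by now apply ev_nonneg.
  destruct (Req_dec (ev l f) 0) as [E|].
  - rewrite E in *. rewrite (rpow_0 0) by lra.
    destruct (Rle_dec (ev l (fun x => rpow (f x) q)) 0) as [|Hn]; [assumption|].
    set (e := ev l (fun x => rpow (f x) q)) in *.
    (* With mean zero, [T] reads [e <= (1 - q) m^q] for all [m > 0]; this [m] makes it
       [e <= (1 - q) e], impossible for [e > 0]. *)
    assert (H := T (rpow e (1 / q)) ltac:(apply rpow_pos; lra)).
    rewrite rpow_inv_cancel in H by lra. nra.
  - assert (H1 := T (ev l f) ltac:(lra)).
    replace ((1 - q) * rpow (ev l f) q + q * (rpow (ev l f) q / ev l f) * ev l f)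
      with (rpow (ev l f) q) in H1 by (field; lra).
    exact H1.
Qed.

(** * Independent draws, uniform positions and random signs *)

Definition upd {X : Type} (u : nat -> X) (k : nat) (y : X) : nat -> X :=
  fun i => if Nat.eq_dec i k then y else u i.

Lemma upd_same {X : Type} (u : nat -> X) k y : upd u k y k = y.
Proof. unfold upd; destruct (Nat.eq_dec k k); congruence. Qed.

Lemma upd_other {X : Type} (u : nat -> X) k y i : i <> k -> upd u k y i = u i.
Proof. unfold upd; destruct (Nat.eq_dec i k); congruence. Qed.

Lemma upd_comm {X : Type} (u : nat -> X) k y i z :
  i <> k -> upd (upd u k y) i z = upd (upd u i z) k y.
Proof.
  intros H; apply functional_extensionality; intros j; unfold upd.
  destruct (Nat.eq_dec j i), (Nat.eq_dec j k); congruence.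
Qed.

(** Independent draws stored as a function, with value [x0] from index [k] on. The last draw is
    outermost, so an induction on [k] can condition on it. *)
Fixpoint diid {X : Type} (x0 : X) (l : list (R * X)) (k : nat) : list (R * (nat -> X)) :=
  match k with
  | O => dret (fun _ => x0)
  | S k' => dbind l (fun y => dbind (diid x0 l k') (fun u => dret (upd u k' y)))
  end.

Lemma law_diid {X : Type} (x0 : X) l k : law l -> law (diid x0 l k).
Proof.
  intros Hl; induction k as [|k IH]; simpl; [apply law_dret|].
  apply law_dbind; auto. intros y; apply law_dbind; auto. intros u; apply law_dret.
Qed.

Lemma ev_diid_S {X : Type} (x0 : X) l k f :
  ev (diid x0 l (S k)) f = ev l (fun y => ev (diid x0 l k) (fun u => f (upd u k y))).
Proof.
  simpl. rewrite ev_dbind. apply ev_ext; intros y. rewrite ev_dbind.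
  apply ev_ext; intros u. apply ev_dret.
Qed.

Fixpoint prodR (n : nat) (f : nat -> R) : R :=
  match n with
  | O => 1
  | S k => prodR k f * f k
  end.

Lemma prodR_ext n f g : (forall i, (i < n)%nat -> f i = g i) -> prodR n f = prodR n g.
Proof.
  induction n as [|n IH]; intros H; simpl; [reflexivity|].
  rewrite IH, (H n); auto.
Qed.

Lemma ev_diid_prod {X : Type} (x0 : X) l k (g : X -> R) :
  ev (diid x0 l k) (fun u => prodR k (fun b => g (u b))) = ev l g ^ k.
Proof.
  induction k as [|k IH]; [simpl; lra|].
  rewrite ev_diid_S.
  rewrite (ev_ext l _ (fun y => ev l g ^ k * g y)).
  - rewrite ev_scal; simpl; lra.
  - intros y. rewrite <- IH. rewrite Rmult_comm, <- ev_scal.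
    apply ev_ext; intros u. simpl. rewrite upd_same, Rmult_comm. f_equal.
    apply prodR_ext; intros i Hi. now rewrite upd_other by lia.
Qed.

Definition dunif (m : nat) : list (R * nat) := map (fun t => (/ INR m, t)) (seq 0 m).

Lemma ev_dunif m f : ev (dunif m) f = / INR m * sumR m f.
Proof.
  unfold dunif. set (c := / INR m). clearbody c.
  induction m as [|m IH]; [simpl; lra|].
  rewrite seq_S, map_app, ev_app, IH. simpl; lra.
Qed.

Lemma law_dunif m : (0 < m)%nat -> law (dunif m).
Proof.
  intros Hm. assert (0 < INR m) by now apply lt_0_INR. split.
  - apply Forall_map, Forall_forall. intros t _; simpl.
    left; now apply Rinv_0_lt_compat.
  - rewrite ev_dunif, sumR_const. field; lra.
Qed.

Definition sgn (b : bool) : R := if b then 1 else -1.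

Lemma Rabs_sgn b : Rabs (sgn b) = 1.
Proof. destruct b; simpl; unfold Rabs; destruct Rcase_abs; lra. Qed.

Definition dsign : list (R * bool) := (1 / 2, true) :: (1 / 2, false) :: nil.

Lemma law_dsign : law dsign.
Proof. split; [repeat constructor; simpl; lra|simpl; lra]. Qed.

Lemma ev_dsign f : ev dsign f = (f true + f false) / 2.
Proof. simpl; lra. Qed.

(** The cross terms cancel between the two signs. The offset [c] carries the terms already drawn
    through the induction. *)
Lemma ev_signs_sqr k c (a : nat -> R) :
  ev (diid true dsign k) (fun e =>
    (c + sumR k (fun j => a j * sgn (e j))) * (c + sumR k (fun j => a j * sgn (e j))))
  = c * c + sumR k (fun j => a j * a j).
Proof.
  revert c; induction k as [|k IH]; intros c; [simpl; lra|].
  rewrite ev_diid_S, ev_dsign.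
  assert (E : forall y, ev (diid true dsign k) (fun u =>
     (c + sumR (S k) (fun j => a j * sgn (upd u k y j)))
     * (c + sumR (S k) (fun j => a j * sgn (upd u k y j))))
     = (c + a k * sgn y) * (c + a k * sgn y) + sumR k (fun j => a j * a j)).
  { intros y. rewrite <- IH. apply ev_ext; intros u. simpl. rewrite upd_same.
    rewrite (sumR_ext k (fun j => a j * sgn (upd u k y j)) (fun j => a j * sgn (u j))).
    - ring.
    - intros i Hi; now rewrite upd_other by lia. }
  rewrite !E; simpl; lra.
Qed.

Definition ind (Q : Prop) : R := if excluded_middle_informative Q then 1 else 0.

Lemma ind_true (Q : Prop) : Q -> ind Q = 1.
Proof. unfold ind; destruct (excluded_middle_informative Q); tauto. Qed.

Lemma ind_false (Q : Prop) : ~ Q -> ind Q = 0.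
Proof. unfold ind; destruct (excluded_middle_informative Q); tauto. Qed.

Lemma ind_bounds (Q : Prop) : 0 <= ind Q <= 1.
Proof. unfold ind; destruct (excluded_middle_informative Q); lra. Qed.

(** * Averaging over the probability space *)

Lemma pred_ext {W : Type} (A B : W -> Prop) : (forall w, A w <-> B w) -> A = B.
Proof.
  intros H; apply functional_extensionality; intros w; now apply propositional_extensionality.
Qed.

(** Countable additivity on a sequence of empty events makes a constant series converge, so the
    constant is 0. *)
Lemma prob_empty {W : Type} (F : (W -> Prop) -> Prop) P :
  prob_space F P -> P (fun _ => False) = 0.
Proof.
  intros [[HT [HC HU]] [Hpos [H1 Hadd]]].
  assert (H := Hadd (fun _ _ => False)). cbv beta in H.
  replace (fun w : W => exists k : nat, False) with (fun _ : W => False) in H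
    by (apply pred_ext; intros w; split; [tauto|intros [_ []]]).
  assert (HF : F (fun _ : W => False)).
  { replace (fun _ : W => False) with (fun _ : W => ~ True)
      by (apply pred_ext; tauto). auto. }
  specialize (H ltac:(auto) ltac:(auto)). set (c := P (fun _ : W => False)) in *.
  assert (Hc : 0 <= c) by now apply Hpos.
  destruct (Req_dec c 0) as [|Hn]; [assumption|].
  (* Tolerance [c] is violated: the partial sum of index [S N] has [N + 2] terms and exceeds [c] by
     at least [c]. *)
  destruct (H c ltac:(lra)) as [N HN].
  specialize (HN (S N) ltac:(lia)). unfold Rdist in HN.
  rewrite sum_cte in HN. assert (0 <= INR N) by apply pos_INR.
  rewrite !S_INR in HN. assert (0 <= c * INR N) by now apply Rmult_le_pos.
  replace (c * (INR N + 1 + 1) - c) with (c * INR N + c) in HN by ring.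
  rewrite Rabs_pos_eq in HN by lra. lra.
Qed.

Lemma event_or {W : Type} (F : (W -> Prop) -> Prop) A B :
  sigma_algebra F -> F A -> F B -> F (fun w => A w \/ B w).
Proof.
  intros [_ [_ HU]] HA HB.
  assert (H := HU (fun k => match k with O => A | _ => B end)).
  replace (fun w => A w \/ B w)
    with (fun w => exists k : nat, (match k with O => A | _ => B end) w).
  - apply H; intros [|k]; assumption.
  - apply pred_ext; intros w; split.
    + intros [[|k] Hk]; auto.
    + intros [Hw|Hw]; [exists O|exists 1%nat]; assumption.
Qed.

Lemma event_and {W : Type} (F : (W -> Prop) -> Prop) A B :
  sigma_algebra F -> F A -> F B -> F (fun w => A w /\ B w).
Proof.
  intros HS HA HB.
  replace (fun w => A w /\ B w) with (fun w => ~ (~ A w \/ ~ B w))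
    by (apply pred_ext; intros w; tauto).
  assert (HC := proj1 (proj2 HS)). apply HC, event_or; auto.
Qed.

(** Countable additivity after padding with empty events. *)
Lemma prob_or {W : Type} (F : (W -> Prop) -> Prop) P A B :
  prob_space F P -> F A -> F B -> (forall w, A w -> B w -> False) ->
  P (fun w => A w \/ B w) = P A + P B.
Proof.
  intros HP HA HB Hd. assert (H0 := prob_empty F P HP).
  destruct HP as [[HT [HC HU]] [Hpos [H1 Hadd]]].
  assert (HF : F (fun _ : W => False)).
  { replace (fun _ : W => False) with (fun _ : W => ~ True)
      by (apply pred_ext; tauto). auto. }
  pose (E := fun k : nat => match k with O => A | 1%nat => B | _ => fun _ => False end).
  assert (H := Hadd E ltac:(intros [|[|k]]; assumption)).
  replace (fun w => A w \/ B w) with (fun w => exists k, E k w).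
  - assert (Hs : infinite_sum (fun k => P (E k)) (P A + P B)).
    { intros e He. exists 1%nat. intros n Hn.
      replace (sum_f_R0 (fun k => P (E k)) n) with (P A + P B).
      - unfold Rdist; rewrite Rminus_diag, Rabs_R0; lra.
      - destruct n as [|n]; [lia|]. clear Hn.
        induction n as [|n IH]; simpl; [reflexivity|].
        simpl in IH; rewrite <- IH. unfold E; rewrite H0; lra. }
    apply uniqueness_sum with (2 := Hs). apply H.
    intros [|[|i]] [|[|j]] w Hij; simpl; eauto; lia.
  - apply pred_ext; intros w; split.
    + intros [[|[|k]] Hk]; simpl in Hk; tauto.
    + intros [Hw|Hw]; [exists O|exists 1%nat]; assumption.
Qed.

(** A Fubini inequality obtained without integrating over the probability space. The induction on
    [l] splits [D] along the event [h x] of the first point: inside it the rest of the list has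
    budget [t - v], outside it [t]. *)
Lemma averaging_on {W X : Type} (F : (W -> Prop) -> Prop) P (h : X -> W -> Prop)
  (l : list (R * X)) :
  prob_space F P -> (forall x, F (h x)) -> forall D t, F D ->
  (forall w, D w -> ev l (fun x => ind (h x w)) <= t) ->
  ev l (fun x => P (fun w => h x w /\ D w)) <= t * P D.
Proof.
  intros HP Hh. assert (HS := proj1 HP).
  induction l as [|[v x] l IH]; intros D t HD Ht; simpl in *.
  - assert (0 <= P D) by (apply (proj1 (proj2 HP)); assumption).
    (* An outcome in [D] forces [0 <= t]; for empty [D] the number [t] may be negative, and
       [P D = 0] is used instead. *)
    destruct (classic (exists w, D w)) as [[w Hw]|Hn].
    + specialize (Ht w Hw). now apply Rmult_le_pos.
    + replace D with (fun _ : W => False)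
        by (apply pred_ext; intros w; split; [tauto|intros Hw; apply Hn; eauto]).
      rewrite (prob_empty F P HP); lra.
  - assert (F1 : F (fun w => h x w /\ D w)) by now apply event_and.
    assert (F2 : F (fun w => ~ h x w /\ D w))
      by (apply event_and; auto; apply (proj1 (proj2 HS)); auto).
    assert (I1 := IH (fun w => h x w /\ D w) (t - v) F1).
    assert (I2 := IH (fun w => ~ h x w /\ D w) t F2).
    assert (HD2 : P D = P (fun w => h x w /\ D w) + P (fun w => ~ h x w /\ D w)).
    { rewrite <- (prob_or F P) by (tauto || assumption). f_equal.
      apply pred_ext; intros w; tauto. }
    assert (HE : ev l (fun y => P (fun w => h y w /\ D w))
      = ev l (fun y => P (fun w => h y w /\ (h x w /\ D w)))
        + ev l (fun y => P (fun w => h y w /\ (~ h x w /\ D w)))).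
    { rewrite <- ev_plus. apply ev_ext; intros y.
      rewrite <- (prob_or F P); try (tauto || now apply event_and).
      f_equal. apply pred_ext; intros w; tauto. }
    rewrite HE, HD2.
    assert (J1 : ev l (fun y => P (fun w => h y w /\ (h x w /\ D w)))
                 <= (t - v) * P (fun w => h x w /\ D w)).
    { apply I1. intros w [Hx Hw]. specialize (Ht w Hw). rewrite ind_true in Ht by assumption. lra. }
    assert (J2 : ev l (fun y => P (fun w => h y w /\ (~ h x w /\ D w)))
                 <= t * P (fun w => ~ h x w /\ D w)).
    { apply I2. intros w [Hx Hw]. specialize (Ht w Hw). rewrite ind_false in Ht by assumption. lra. }
    nra.
Qed.

(** If every outcome lay in at most an [s] fraction of the events, their average probability would
    be at most [s < t]. *)
Lemma averaging {W X : Type} (F : (W -> Prop) -> Prop) P (h : X -> W -> Prop)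
  (l : list (R * X)) (t s : R) :
  prob_space F P -> law l -> (forall x, F (h x)) -> (forall x, t <= P (h x)) -> s < t ->
  exists w, s < ev l (fun x => ind (h x w)).
Proof.
  intros HP Hl Hh Ht Hst. apply NNPP; intros Hn.
  assert (H := averaging_on F P h l HP Hh (fun _ => True) s (proj1 (proj1 HP))).
  rewrite (proj1 (proj2 (proj2 HP))) in H.
  assert (H1 : ev l (fun x => P (fun w => h x w /\ True)) <= s * 1).
  { apply H. intros w _. apply Rnot_lt_le; intros Hw; apply Hn; eauto. }
  assert (H2 : ev l (fun _ => t) <= ev l (fun x => P (fun w => h x w /\ True))).
  { apply ev_le; auto. intros x. replace (fun w => h x w /\ True) with (h x); auto.
    apply pred_ext; intros w; tauto. }
  rewrite ev_const in H2 by assumption. lra.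
Qed.

(** * Linear algebra *)

(** The increasing enumeration of the naturals other than [k], used to delete one variable of a
    linear system. *)
Definition skip (k i : nat) : nat := if (i <? k)%nat then i else S i.

Lemma sumR_skip n k f :
  (k <= n)%nat -> sumR (S n) f = f k + sumR n (fun i => f (skip k i)).
Proof.
  induction n as [|n IH]; intros Hk.
  - replace k with O by lia; simpl; lra.
  - destruct (Nat.eq_dec k (S n)) as [->|].
    + rewrite (sumR_ext _ (fun i => f (skip (S n) i)) f).
      * simpl; lra.
      * intros i Hi; unfold skip; destruct (Nat.ltb_spec i (S n)); auto; lia.
    + change (sumR (S n) f + f (S n) = f k + (sumR n (fun i => f (skip k i)) + f (skip k n))).
      rewrite IH by lia. unfold skip at 3. destruct (Nat.ltb_spec n k); [lia|lra].
Qed.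

(** Gaussian elimination by induction on the number of rows: a nonzero entry of row [r] eliminates
    its variable. *)
Lemma kernel_nontrivial r : forall d (M : nat -> nat -> R), (r < d)%nat ->
  exists x : nat -> R, (exists j, (j < d)%nat /\ x j <> 0) /\
    forall i, (i < r)%nat -> sumR d (fun j => M i j * x j) = 0.
Proof.
  induction r as [|r IH]; intros d M Hd.
  - exists (fun _ => 1); split; [exists O; split; [lia|lra]|intros; lia].
  - destruct (classic (exists k, (k < d)%nat /\ M r k <> 0)) as [[k [Hk Hp]]|Hn].
    + destruct d as [|d]; [lia|].
      (* The rows after clearing column [k] with multiples of row [r]. *)
      destruct (IH d (fun i j => M i (skip k j) - M i k * M r (skip k j) / M r k) ltac:(lia))
        as [x [[j [Hj Hx]] Hker]].
      pose (s := sumR d (fun j => M r (skip k j) * x j)).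
      (* Back substitution: coordinate [k] is chosen so that row [r] vanishes. *)
      pose (y := fun i => if (i <? k)%nat then x i
                          else if (i =? k)%nat then - s / M r k else x (pred i)).
      assert (Hys : forall j, y (skip k j) = x j).
      { intros i; unfold y, skip. destruct (Nat.ltb_spec i k) as [H|H].
        - destruct (Nat.ltb_spec i k); [reflexivity|lia].
        - destruct (Nat.ltb_spec (S i) k); [lia|].
          destruct (Nat.eqb_spec (S i) k); [lia|reflexivity]. }
      assert (Hyk : y k = - s / M r k).
      { unfold y. rewrite Nat.ltb_irrefl, Nat.eqb_refl; reflexivity. }
      exists y; split.
      * exists (skip k j); rewrite Hys; split; [|assumption].
        unfold skip; destruct (j <? k)%nat; lia.
      * intros i Hi. rewrite (sumR_skip d k) by lia. rewrite Hyk.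
        rewrite (sumR_ext d _ (fun j => M i (skip k j) * x j)) by (intros; now rewrite Hys).
        destruct (Nat.eq_dec i r) as [->|].
        -- fold s. field; assumption.
        -- specialize (Hker i ltac:(lia)).
           rewrite (sumR_ext d _ (fun j => M i (skip k j) * x j
             + (- (M i k / M r k)) * (M r (skip k j) * x j))) in Hker
             by (intros; field; assumption).
           rewrite sumR_plus, sumR_scal in Hker. fold s in Hker.
           replace (M i k * (- s / M r k)) with (- (M i k / M r k) * s) by (field; assumption).
           lra.
    + destruct (IH d M ltac:(lia)) as [x [Hx Hker]].
      exists x; split; [assumption|]. intros i Hi.
      destruct (Nat.eq_dec i r) as [->|]; [|apply Hker; lia].
      apply sumR_zero. intros j Hj.
      destruct (Req_dec (M r j) 0) as [->|]; [lra|exfalso; eauto].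
Qed.

(** * Consequences of the embedding property *)

(** Passes from norms to sums of [p]-th powers, the form in which the embedding is used. *)
Lemma lpnorm_le p m1 m2 y1 y2 k : 1 <= p -> 0 <= k ->
  lpnorm p m1 y1 <= k * lpnorm p m2 y2 ->
  sumR m1 (fun i => rpow (Rabs (y1 i)) p) <= rpow k p * sumR m2 (fun i => rpow (Rabs (y2 i)) p).
Proof.
  intros Hp Hk H. apply rpow_le with (a := p) in H; [|lra].
  unfold lpnorm in H. rewrite rpow_mult in H by (assumption || apply rpow_nonneg).
  rewrite !rpow_inv_cancel in H
    by (lra || (apply sumR_nonneg; intros; apply rpow_nonneg)).
  exact H.
Qed.

Lemma matvec_basis d A k i : (k < d)%nat ->
  matvec d A (fun j => if Nat.eq_dec j k then 1 else 0) i = A i k.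
Proof.
  intros Hk. unfold matvec. apply sumR_delta with k; auto.
  - intros j _ Hj; destruct (Nat.eq_dec j k); [congruence|lra].
  - destruct (Nat.eq_dec k k); [lra|congruence].
Qed.

(** Test on the matrix whose image is spanned by the first [d] coordinate vectors: if [r < d], a
    nonzero vector of this image is sent to 0, against the lower bound of the embedding. *)
Lemma embedding_rank {W : Type} (F : (W -> Prop) -> Prop) P p n d r Pi kappa :
  1 <= p -> (d <= n)%nat -> prob_space F P -> lp_OSE F P p n d r Pi kappa -> (d <= r)%nat.
Proof.
  intros Hp Hdn HP [_ H].
  destruct (le_lt_dec d r) as [|Hlt]; [assumption|exfalso].
  pose (A := fun i j : nat => if Nat.eq_dec j i then 1 else 0).
  destruct (H A) as [E [FE [PE HE]]].
  destruct (classic (exists w, E w)) as [[w Hw]|Hn].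
  2:{ replace E with (fun _ : W => False) in PE
        by (apply pred_ext; intros w; split; [tauto|intros Hw; apply Hn; eauto]).
      rewrite (prob_empty F P HP) in PE; lra. }
  destruct (kernel_nontrivial r d (Pi w) Hlt) as [x [[j [Hj Hx]] Hker]].
  assert (HA : forall i, matvec d A x i = if (i <? d)%nat then x i else 0).
  { intros i; unfold matvec. destruct (Nat.ltb_spec i d).
    - apply sumR_delta with i; auto; unfold A.
      + intros k _ Hk; destruct (Nat.eq_dec k i); [congruence|lra].
      + destruct (Nat.eq_dec i i); [lra|congruence].
    - apply sumR_zero; intros k Hk; unfold A. destruct (Nat.eq_dec k i); [lia|lra]. }
  destruct (HE w Hw x) as [H1 _]. rewrite <- (Rmult_1_l (lpnorm p r _)) in H1.
  apply lpnorm_le in H1; [|lra|lra].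
  rewrite (sumR_zero r) in H1.
  - assert (H2 : rpow (Rabs (matvec d A x j)) p <= sumR n (fun i => rpow (Rabs (matvec d A x i)) p)).
    { apply (sumR_term n (fun i => rpow (Rabs (matvec d A x i)) p)); [|lia].
      intros; apply rpow_nonneg. }
    rewrite HA in H2 at 1. destruct (Nat.ltb_spec j d); [|lia].
    assert (H3 := rpow_pos (Rabs (x j)) p (Rabs_pos_lt _ Hx)). lra.
  - intros i Hi. rewrite rpow_0; [reflexivity|].
    replace (matvec n (Pi w) (matvec d A x) i) with 0; [rewrite Rabs_R0; lra|].
    rewrite <- (Hker i Hi). unfold matvec at 1. symmetry.
    rewrite (sumR_extend d n) by
      (lia || (intros k Hk; rewrite HA; destruct (Nat.ltb_spec k d); [lia|lra])).
    apply sumR_ext; intros k Hk. rewrite HA.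
    destruct (Nat.ltb_spec k d); [reflexivity|lia].
Qed.
(** * Random sparse vectors *)

Definition dentry (m : nat) : list (R * (nat * bool)) :=
  dbind (dunif m) (fun t => dbind dsign (fun s => dret (t, s))).

Lemma law_dentry m : (0 < m)%nat -> law (dentry m).
Proof.
  intros Hm. apply law_dbind; [now apply law_dunif|]. intros t.
  apply law_dbind; [apply law_dsign|]. intros s; apply law_dret.
Qed.

Lemma ev_dentry m f :
  ev (dentry m) f = / INR m * sumR m (fun t => (f (t, true) + f (t, false)) / 2).
Proof.
  unfold dentry. rewrite ev_dbind, ev_dunif. f_equal. apply sumR_ext; intros t _.
  rewrite ev_dbind, ev_dsign, !ev_dret; reflexivity.
Qed.

Definition dchoice (m k : nat) : list (R * (nat -> nat * bool)) :=
  diid (O, true) (dentry m) k.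

Lemma law_dchoice m k : (0 < m)%nat -> law (dchoice m k).
Proof. intros; now apply law_diid, law_dentry. Qed.

Lemma ind_mean_bounds m (h : nat -> Prop) : (0 < m)%nat ->
  0 <= / INR m * sumR m (fun t => ind (h t)) <= 1.
Proof.
  intros Hm. assert (0 < INR m) by now apply lt_0_INR.
  assert (0 <= sumR m (fun t => ind (h t))) by (apply sumR_nonneg; intros; apply ind_bounds).
  assert (sumR m (fun t => ind (h t)) <= INR m).
  { rewrite <- (Rmult_1_r (INR m)), <- (sumR_const m 1).
    apply sumR_le; intros; apply ind_bounds. }
  assert (0 < / INR m) by now apply Rinv_0_lt_compat.
  split; [nra|]. apply Rmult_le_reg_l with (INR m); [assumption|].
  rewrite <- Rmult_assoc, Rinv_r; lra.
Qed.

(** Condition on the last block: if its position is hit, one of the two signs is bad whatever the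
    other blocks are; if not, induction applies to those. So half the chance that some block is hit
    is a lower bound, and [S / (1 + S)] is a lower bound for that chance that survives the
    recursion. *)
Lemma bad_probability m k (hit : nat -> nat -> Prop) (Bad : (nat -> nat * bool) -> Prop) S :
  (0 < m)%nat ->
  (forall u b t, (b < k)%nat -> (t < m)%nat -> hit b t ->
     Bad (upd u b (t, true)) \/ Bad (upd u b (t, false))) ->
  S = sumR k (fun b => / INR m * sumR m (fun t => ind (hit b t))) ->
  1 / 2 * (S / (1 + S)) <= ev (dchoice m k) (fun u => ind (Bad u)).
Proof.
  intros Hm. revert Bad S; induction k as [|k IH]; intros Bad S Hhit ES.
  - simpl in ES; subst S. replace (1 / 2 * (0 / (1 + 0))) with 0 by field.
    apply ev_nonneg; [now apply law_dchoice|]. intros; apply ind_bounds.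
  - simpl in ES. set (s := sumR k _) in ES. set (h := / INR m * _) in ES.
    assert (Hs : 0 <= s)
      by (apply sumR_nonneg; intros; now apply ind_mean_bounds).
    assert (Hh : 0 <= h <= 1) by now apply ind_mean_bounds.
    pose (c := s / (1 + s)).
    assert (Hc : 0 <= c) by (apply Rle_mult_inv_pos; lra).
    unfold dchoice. rewrite ev_diid_S, ev_dentry. fold (dchoice m k).
    apply Rle_trans with (/ INR m * sumR m (fun t => 1 / 2 * c + 1 / 2 * (1 - c) * ind (hit k t))).
    + rewrite sumR_plus, sumR_const, sumR_scal.
      assert (0 < INR m) by now apply lt_0_INR.
      replace (/ INR m * (INR m * (1 / 2 * c) + 1 / 2 * (1 - c) * sumR m (fun t => ind (hit k t))))
        with (1 / 2 * (c + (1 - c) * h)) by (unfold h; field; lra).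
      replace (c + (1 - c) * h) with ((s + h) / (1 + s)) by (unfold c; field; lra).
      apply Rmult_le_compat_l; [lra|]. subst S. unfold Rdiv.
      apply Rmult_le_compat_l; [lra|]. apply Rinv_le_contravar; lra.
    + apply Rmult_le_compat_l; [left; now apply Rinv_0_lt_compat, lt_0_INR|].
      apply sumR_le; intros t Ht.
      destruct (classic (hit k t)) as [H|H].
      * rewrite ind_true by assumption.
        assert (Q : 1 <= ev (dchoice m k) (fun u => ind (Bad (upd u k (t, true)))
                                     + ind (Bad (upd u k (t, false))))).
        { rewrite <- (ev_const (dchoice m k) 1) at 1 by now apply law_dchoice.
          apply ev_le; [now apply law_dchoice|]. intros u.
          assert (B1 := ind_bounds (Bad (upd u k (t, true)))).
          assert (B2 := ind_bounds (Bad (upd u k (t, false)))).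
          destruct (Hhit u k t ltac:(lia) Ht H) as [Q|Q]; rewrite (ind_true _ Q); lra. }
        rewrite ev_plus in Q. lra.
      * rewrite ind_false by assumption.
        assert (Q : forall y, 1 / 2 * c <= ev (dchoice m k) (fun u => ind (Bad (upd u k y)))).
        { intros y. apply (IH (fun u => Bad (upd u k y)) s); [|reflexivity].
          intros u b t' Hb Ht' Hbt. cbv beta. rewrite !(upd_comm u b _ k) by lia.
          apply Hhit; auto; lia. }
        assert (Q1 := Q (t, true)). assert (Q2 := Q (t, false)). lra.
Qed.

(** Block [b] of length [m] carries the sign [snd (u b)] at offset [fst (u b)], and is zero if that
    offset is not below [m]; hence its norm is only bounded above. *)
Definition blockvec (k m : nat) (u : nat -> nat * bool) (i : nat) : R :=
  if (i <? k * m)%nat then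
    if (i mod m =? fst (u (i / m)))%nat then sgn (snd (u (i / m)%nat)) else 0
  else 0.

Lemma block_div b m t : (t < m)%nat -> ((b * m + t) / m)%nat = b.
Proof.
  intros Ht. rewrite Nat.div_add_l by lia. rewrite Nat.div_small by assumption; lia.
Qed.

Lemma block_mod b m t : (t < m)%nat -> ((b * m + t) mod m)%nat = t.
Proof.
  intros Ht. rewrite Nat.add_comm, Nat.Div0.mod_add. now apply Nat.mod_small.
Qed.

Lemma block_lt b k m t : (b < k)%nat -> (t < m)%nat -> (b * m + t < k * m)%nat.
Proof. intros; nia. Qed.

Lemma blockvec_norm k m u p :
  sumR (k * m) (fun i => rpow (Rabs (blockvec k m u i)) p) <= INR k.
Proof.
  rewrite sumR_blocks. rewrite <- (Rmult_1_r (INR k)), <- sumR_const.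
  apply sumR_le; intros b Hb.
  rewrite (sumR_ext m _ (fun t => if (t =? fst (u b))%nat then 1 else 0)).
  - destruct (le_lt_dec m (fst (u b))) as [H|H].
    + rewrite sumR_zero; [lra|]. intros i Hi.
      destruct (Nat.eqb_spec i (fst (u b))); [lia|reflexivity].
    + right; apply sumR_delta with (fst (u b)); auto.
      * intros i _ Hi. destruct (Nat.eqb_spec i (fst (u b))); [lia|reflexivity].
      * now rewrite Nat.eqb_refl.
  - intros t Ht. unfold blockvec. rewrite block_div, block_mod by assumption.
    assert (H := block_lt b k m t Hb Ht). apply Nat.ltb_lt in H; rewrite H.
    destruct (t =? fst (u b))%nat; [rewrite Rabs_sgn; apply rpow_1_l|].
    rewrite Rabs_R0; apply rpow_0; lra.
Qed.

Lemma blockvec_flip k m u b t i : (b < k)%nat -> (t < m)%nat ->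
  blockvec k m (upd u b (t, true)) i - blockvec k m (upd u b (t, false)) i
  = if Nat.eq_dec i (b * m + t) then 2 else 0.
Proof.
  intros Hb Ht. unfold blockvec, upd.
  destruct (Nat.eq_dec i (b * m + t)) as [->|Hi].
  - assert (H := block_lt b k m t Hb Ht). apply Nat.ltb_lt in H; rewrite H.
    rewrite block_div, block_mod by assumption.
    destruct (Nat.eq_dec b b); [|congruence]. simpl. rewrite Nat.eqb_refl. lra.
  - destruct (i <? k * m)%nat; [|lra].
    destruct (Nat.eq_dec (i / m) b) as [E|]; [|lra]. simpl.
    destruct (Nat.eqb_spec (i mod m) t) as [E'|]; [|lra].
    exfalso; apply Hi. rewrite <- E, <- E', Nat.mul_comm. apply Nat.div_mod; lia.
Qed.

(** * Columns of large and of small norm in a fixed matrix *)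

Definition colnorm (p : R) (r : nat) (M : nat -> nat -> R) (j : nat) : R :=
  sumR r (fun i => rpow (Rabs (M i j)) p).

(** The upper half of the embedding property for one vector, in [p]-th powers; [K] will be
    [kappa^p]. *)
Definition dilates_le (p K : R) (r N : nat) (M : nat -> nat -> R) (X : nat -> R) : Prop :=
  sumR r (fun i => rpow (Rabs (matvec N M X i)) p) <= K * sumR N (fun i => rpow (Rabs (X i)) p).

(* [2 M_ij] is the difference of the images of the two vectors obtained by
   flipping the sign at [j], so a large column spoils one of them. *)
Lemma flip_bad p K r k m M u b t : 0 <= p -> 0 <= K -> (b < k)%nat -> (t < m)%nat ->
  2 * K * INR k < colnorm p r M (b * m + t) ->
  ~ dilates_le p K r (k * m) M (blockvec k m (upd u b (t, true))) \/
  ~ dilates_le p K r (k * m) M (blockvec k m (upd u b (t, false))).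
Proof.
  intros Hp HK Hb Ht Hbig. apply not_and_or; intros [H1 H2].
  unfold dilates_le in *.
  assert (N1 := blockvec_norm k m (upd u b (t, true)) p).
  assert (N2 := blockvec_norm k m (upd u b (t, false)) p).
  apply (Rmult_le_compat_l K) in N1; [|assumption].
  apply (Rmult_le_compat_l K) in N2; [|assumption].
  set (X1 := blockvec k m (upd u b (t, true))) in *.
  set (X2 := blockvec k m (upd u b (t, false))) in *.
  assert (HM : forall i, M i (b * m + t)%nat
    = (matvec (k * m) M X1 i - matvec (k * m) M X2 i) / 2).
  { intros i. unfold matvec.
    assert (E : sumR (k * m) (fun j => M i j * X1 j)
      = sumR (k * m) (fun j => M i j * X2 j) + 2 * M i (b * m + t)%nat).
    { rewrite (sumR_ext _ (fun j => M i j * X1 j)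
        (fun j => M i j * X2 j + M i j * (X1 j - X2 j))) by (intros; ring).
      rewrite sumR_plus. f_equal.
      apply sumR_delta with (b * m + t)%nat; [now apply block_lt| |].
      - intros j _ Hj. unfold X1, X2; rewrite blockvec_flip by assumption.
        destruct (Nat.eq_dec j (b * m + t)); [congruence|ring].
      - unfold X1, X2; rewrite blockvec_flip by assumption.
        destruct (Nat.eq_dec (b * m + t) (b * m + t)); [ring|congruence]. }
    lra. }
  assert (Hc : colnorm p r M (b * m + t) <=
    sumR r (fun i => rpow (Rabs (matvec (k * m) M X1 i)) p)
    + sumR r (fun i => rpow (Rabs (matvec (k * m) M X2 i)) p)).
  { unfold colnorm. rewrite <- sumR_plus. apply sumR_le; intros i Hi.
    set (a := matvec (k * m) M X1 i) in *. set (c := matvec (k * m) M X2 i) in *.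
    assert (Pa := rpow_nonneg (Rabs a) p). assert (Pc := rpow_nonneg (Rabs c) p).
    (* An entry is half the difference of [a] and [c], so the larger of the two dominates it and no
       factor depending on [p] appears. *)
    assert (HR : Rabs (M i (b * m + t)%nat) <= Rabs a \/ Rabs (M i (b * m + t)%nat) <= Rabs c).
    { rewrite HM; fold a c. unfold Rabs; repeat destruct Rcase_abs; lra. }
    destruct HR as [HR|HR]; apply rpow_le with (a := p) in HR; lra. }
  lra.
Qed.

Definition dcolumn (L : nat) : list (R * (nat -> R)) :=
  dbind (dunif (S L)) (fun s =>
    dbind (dchoice (2 ^ (L - s)) (2 ^ s)) (fun u =>
      dret (blockvec (2 ^ s) (2 ^ (L - s)) u))).

Lemma pow2_pos s : (0 < 2 ^ s)%nat.
Proof. assert (H := Nat.pow_nonzero 2 s); lia. Qed.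

Lemma law_dcolumn L : law (dcolumn L).
Proof.
  apply law_dbind; [apply law_dunif; lia|]. intros s.
  apply law_dbind; [apply law_dchoice, pow2_pos|]. intros u; apply law_dret.
Qed.

(** A scale is drawn with probability [1 / (L + 1)], so a vector of scale [s] is bad with
    probability at most [(L + 1) eta]. Through [bad_probability] this bounds [Sg], the number of big
    columns divided by the block length. *)
Lemma few_big_columns p K r L M eta s : 0 <= p -> 0 <= K ->
  ev (dcolumn L) (fun X => ind (~ dilates_le p K r (2 ^ L) M X)) <= eta ->
  INR (S L) * eta <= 1 / 8 -> (s <= L)%nat ->
  2 ^ s * sumR (2 ^ L) (fun j => ind (2 * K * 2 ^ s < colnorm p r M j))
  <= 4 * (INR (S L) * eta) * 2 ^ L.
Proof.
  intros Hp HK Hev Heta Hs.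
  pose (e := fun s => ev (dchoice (2 ^ (L - s)) (2 ^ s)) (fun u =>
    ind (~ dilates_le p K r (2 ^ L) M (blockvec (2 ^ s) (2 ^ (L - s)) u)))).
  assert (HL : 0 < INR (S L)) by (apply lt_0_INR; lia).
  assert (Hes : e s <= INR (S L) * eta).
  { apply Rle_trans with (sumR (S L) e).
    - apply sumR_term; [|lia]. intros i _. apply ev_nonneg; [apply law_dchoice, pow2_pos|].
      intros; apply ind_bounds.
    - unfold dcolumn in Hev. rewrite ev_dbind, ev_dunif in Hev.
      rewrite (sumR_ext (S L) _ e) in Hev.
      + apply (Rmult_le_compat_l (INR (S L))) in Hev; [|lra].
        rewrite <- Rmult_assoc, Rinv_r in Hev; lra.
      + intros i _. rewrite ev_dbind. apply ev_ext; intros u. now rewrite ev_dret. }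
  set (delta := INR (S L) * eta) in *. clearbody delta.
  set (m := (2 ^ (L - s))%nat) in *.
  assert (HN : (2 ^ L = 2 ^ s * m)%nat)
    by (unfold m; rewrite <- Nat.pow_add_r; f_equal; lia).
  assert (Hm : (0 < m)%nat) by apply pow2_pos.
  assert (HmR : 0 < INR m) by now apply lt_0_INR.
  assert (H2s : INR (2 ^ s) = 2 ^ s) by (rewrite pow_INR; reflexivity).
  assert (H2L : 2 ^ L = 2 ^ s * INR m)
    by (rewrite <- H2s, <- mult_INR, <- HN, pow_INR; reflexivity).
  assert (Hpos : 0 < 2 ^ s) by (apply pow_lt; lra).
  pose (hit := fun b t : nat => 2 * K * 2 ^ s < colnorm p r M (b * m + t)).
  set (Sg := sumR (2 ^ s) (fun b => / INR m * sumR m (fun t => ind (hit b t)))).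
  assert (HSg0 : 0 <= Sg)
    by (apply sumR_nonneg; intros; now apply ind_mean_bounds).
  assert (HB : 1 / 2 * (Sg / (1 + Sg)) <= delta).
  { eapply Rle_trans; [|exact Hes]. unfold e; fold m.
    apply (bad_probability m (2 ^ s) hit); [assumption| |reflexivity].
    intros u b t Hb Ht Hh. rewrite HN. apply flip_bad; auto.
    rewrite H2s; exact Hh. }
  (* [Sg <= 2 delta (1 + Sg)], and [delta <= 1/8] lets the left side absorb the [Sg] on the
     right. *)
  assert (HS4 : Sg <= 4 * delta).
  { apply (Rmult_le_compat_r (1 + Sg)) in HB; [|lra].
    replace (1 / 2 * (Sg / (1 + Sg)) * (1 + Sg)) with (1 / 2 * Sg) in HB by (field; lra).
    nra. }
  rewrite HN, sumR_blocks. rewrite H2L.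
  replace (sumR (2 ^ s) (fun b => sumR m (fun t => ind (2 * K * 2 ^ s < colnorm p r M (b * m + t)))))
    with (INR m * Sg).
  - apply Rle_trans with (2 ^ s * INR m * (4 * delta)); [|lra].
    rewrite <- Rmult_assoc. apply Rmult_le_compat_l; [nra|assumption].
  - unfold Sg. rewrite <- sumR_scal. apply sumR_ext; intros b _.
    rewrite <- Rmult_assoc, Rinv_r by lra. rewrite Rmult_1_l; reflexivity.
Qed.

(** If [w > D], it is at most [D] plus the thresholds [D 2^s] below it, and the layer [s = 0]
    already pays for [D]: hence the factor 2. *)
Lemma dyadic_layers L D w : 0 <= D -> 0 <= w <= D * 2 ^ L ->
  w * ind (D < w) <= 2 * sumR (S L) (fun s => D * 2 ^ s * ind (D * 2 ^ s < w)).
Proof.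
  intros HD Hw.
  (* Doubling the cap [D 2^l] on [w] adds at most [D 2^l], and nothing if [w <= D 2^l]. *)
  assert (T : forall l, Rmin w (D * 2 ^ l) <= D + sumR l (fun s => D * 2 ^ s * ind (D * 2 ^ s < w))).
  { induction l as [|l IH]; simpl.
    - rewrite Rmult_1_r. eapply Rle_trans; [apply Rmin_r|lra].
    - destruct (Rlt_dec (D * 2 ^ l) w) as [H|H].
      + rewrite ind_true by assumption. rewrite Rmin_right in IH by lra.
        eapply Rle_trans; [apply Rmin_r|]. lra.
      + rewrite ind_false by assumption. rewrite Rmin_left in IH by lra.
        eapply Rle_trans; [apply Rmin_l|]. lra. }
  specialize (T L). rewrite Rmin_left in T by lra.
  assert (P : forall s, 0 <= D * 2 ^ s * ind (D * 2 ^ s < w)).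
  { intros s. apply Rmult_le_pos; [|apply ind_bounds].
    apply Rmult_le_pos; [assumption|apply pow_le; lra]. }
  destruct (Rlt_dec D w) as [H|H].
  - assert (H0 : D <= sumR (S L) (fun s => D * 2 ^ s * ind (D * 2 ^ s < w))).
    { assert (H0 := sumR_term (S L) (fun s => D * 2 ^ s * ind (D * 2 ^ s < w)) O
        (fun s _ => P s) ltac:(lia)).
      cbv beta in H0. change (2 ^ 0) with 1 in H0. rewrite Rmult_1_r, ind_true in H0 by assumption.
      lra. }
    rewrite ind_true by assumption. specialize (P L).
    change (sumR (S L) ?f) with (sumR L f + f L) in *. cbv beta in *. lra.
  - rewrite ind_false by assumption.
    assert (0 <= sumR (S L) (fun s => D * 2 ^ s * ind (D * 2 ^ s < w))) by (apply sumR_nonneg; auto).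
    lra.
Qed.

(** The count at scale [s] cancels the height [D 2^s], so each of the [L + 1] layers has mass at
    most [D tau 2^L]. *)
Lemma big_columns_mass L W D tau : 0 <= D -> (forall j, 0 <= W j) -> tau < 1 ->
  (forall s, (s <= L)%nat ->
     2 ^ s * sumR (2 ^ L) (fun j => ind (D * 2 ^ s < W j)) <= tau * 2 ^ L) ->
  sumR (2 ^ L) (fun j => W j * ind (D < W j)) <= 2 * D * INR (S L) * tau * 2 ^ L.
Proof.
  intros HD HW Htau H.
  assert (HL : 0 < 2 ^ L) by (apply pow_lt; lra).
  (* At [s = L] fewer than one column, hence none, lies above [D 2^L]; this closes the dyadic
     range. *)
  assert (Hmax : forall j, (j < 2 ^ L)%nat -> W j <= D * 2 ^ L).
  { intros j Hj. apply Rnot_lt_le; intros Hn.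
    assert (H1 := sumR_term (2 ^ L) (fun j => ind (D * 2 ^ L < W j)) j
      (fun i _ => proj1 (ind_bounds _)) Hj). cbv beta in H1.
    rewrite ind_true in H1 by assumption. specialize (H L (le_n L)). nra. }
  apply Rle_trans with (sumR (2 ^ L) (fun j =>
    2 * sumR (S L) (fun s => D * 2 ^ s * ind (D * 2 ^ s < W j)))).
  - apply sumR_le; intros j Hj. apply dyadic_layers; auto.
  - rewrite sumR_scal, sumR_swap.
    apply Rle_trans with (2 * sumR (S L) (fun _ => D * (tau * 2 ^ L))).
    + apply Rmult_le_compat_l; [lra|]. apply sumR_le; intros s Hs.
      rewrite sumR_scal, Rmult_assoc. apply Rmult_le_compat_l; [assumption|].
      apply H; lia.
    + rewrite sumR_const; lra.
Qed.

(** Jensen over the rows reduces to the sum of all squares. In a small column these sum to at most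
    [D^(2/p)], the 2-norm being at most the [p]-norm. *)
Lemma small_columns_mass p r N M D : 1 <= p < 2 -> (0 < r)%nat -> (0 < N)%nat -> 0 <= D ->
  sumR r (fun i => rpow (sumR N (fun j => ind (~ D < colnorm p r M j) * (M i j * M i j))) (p / 2))
  <= D * INR N * rpow (INR r / INR N) (1 - p / 2).
Proof.
  intros Hp Hr HN HD. set (q := p / 2). assert (Hq : 0 < q < 1) by (unfold q; lra).
  assert (Rr : 0 < INR r) by now apply lt_0_INR.
  assert (RN : 0 < INR N) by now apply lt_0_INR.
  set (a := fun i => sumR N (fun j => ind (~ D < colnorm p r M j) * (M i j * M i j))).
  assert (Ha : forall i, 0 <= a i).
  { intros i; apply sumR_nonneg; intros j _. apply Rmult_le_pos; [apply ind_bounds|nra]. }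
  assert (HJ := jensen (dunif r) a q (law_dunif r Hr) Hq Ha). rewrite !ev_dunif in HJ.
  set (T := rpow D (1 / q)). assert (HT : 0 <= T) by apply rpow_nonneg.
  assert (Hsum : sumR r a <= INR N * T).
  { unfold a. rewrite sumR_swap, <- sumR_const. apply sumR_le; intros j _.
    rewrite sumR_scal.
    assert (H0 : 0 <= sumR r (fun i => M i j * M i j)) by (apply sumR_nonneg; intros; nra).
    destruct (Rlt_dec D (colnorm p r M j)) as [H|H].
    - rewrite ind_false by tauto. lra.
    - rewrite ind_true by assumption. rewrite Rmult_1_l.
      rewrite <- (rpow_1_r (sumR _ _)) by assumption.
      replace 1 with (q * (1 / q)) at 1 by (field; lra). rewrite <- rpow_rpow.
      apply rpow_le; [apply Rle_mult_inv_pos; lra|].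
      eapply Rle_trans; [|apply Rnot_lt_le, H]. unfold colnorm.
      eapply Rle_trans; [apply rpow_subadd_sumR; [lra|intros; nra]|].
      right; apply sumR_ext; intros i _. symmetry; apply rpow_abs_sqr. }
  assert (HJ2 : rpow (/ INR r * sumR r a) q <= rpow (INR N / INR r) q * D).
  { replace D with (rpow T q) at 1
      by (unfold T; apply rpow_inv_cancel; lra).
    rewrite <- rpow_mult by (assumption || (apply Rle_mult_inv_pos; lra)).
    apply rpow_le; [lra|].
    replace (INR N / INR r * T) with (/ INR r * (INR N * T)) by (field; lra).
    apply Rmult_le_compat_l; [left; now apply Rinv_0_lt_compat|assumption]. }
  assert (HJ3 := Rle_trans _ _ _ HJ HJ2).
  apply (Rmult_le_compat_l (INR r)) in HJ3; [|lra].
  rewrite <- Rmult_assoc, Rinv_r, Rmult_1_l in HJ3 by lra.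
  (* What remains is the identity [r (N/r)^q = N (r/N)^(1-q)]. *)
  eapply Rle_trans; [exact HJ3|]. right.
  assert (Hx : 0 < INR r / INR N) by (apply Rdiv_lt_0_compat; lra).
  assert (Hxq := rpow_pos _ q Hx).
  replace (INR N / INR r) with (/ (INR r / INR N)) by (field; lra).
  rewrite rpow_Rinv by assumption.
  assert (E : rpow (INR r / INR N) (1 - q) * rpow (INR r / INR N) q = INR r / INR N).
  { rewrite <- rpow_plus. replace (1 - q + q) with 1 by ring. apply rpow_1_r; lra. }
  set (y := rpow (INR r / INR N) (1 - q)) in *. set (z := rpow (INR r / INR N) q) in *.
  replace y with (INR r / INR N / z) by (rewrite <- E; field; lra).
  field; lra.
Qed.

(** Columns are split at [D = 2 K], and subadditivity of [x^(p/2)] separates the two kinds in each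
    row. Big columns enter through their [p]-th powers, bounded with [tau = 4 (L + 1) eta], at most
    [1/2]. *)
Lemma matrix_core p K r L M eta : 1 <= p < 2 -> (0 < r)%nat -> 0 <= K ->
  ev (dcolumn L) (fun X => ind (~ dilates_le p K r (2 ^ L) M X)) <= eta ->
  INR (S L) * eta <= 1 / 8 ->
  sumR r (fun i => rpow (sumR (2 ^ L) (fun j => M i j * M i j)) (p / 2))
  <= 2 * K * 2 ^ L * (rpow (INR r / 2 ^ L) (1 - p / 2) + 8 * (INR (S L) * INR (S L)) * eta).
Proof.
  intros Hp Hr HK Hev Heta.
  assert (H2L : INR (2 ^ L) = 2 ^ L) by (rewrite pow_INR; reflexivity).
  set (D := 2 * K). assert (HD : 0 <= D) by (unfold D; lra).
  assert (Hsmall := small_columns_mass p r (2 ^ L) M D Hp Hr (pow2_pos L) HD).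
  rewrite H2L in Hsmall.
  assert (Hbig := big_columns_mass L (colnorm p r M) D (4 * (INR (S L) * eta)) HD
    (fun j => sumR_nonneg _ _ (fun i _ => rpow_nonneg _ _)) ltac:(lra)
    (fun s Hs => few_big_columns p K r L M eta s ltac:(lra) HK Hev Heta Hs)).
  apply Rle_trans with
    (sumR r (fun i => rpow (sumR (2 ^ L) (fun j => ind (~ D < colnorm p r M j) * (M i j * M i j))) (p / 2))
     + sumR (2 ^ L) (fun j => colnorm p r M j * ind (D < colnorm p r M j))); [|lra].
  clear Hsmall Hbig Hev.
  rewrite (sumR_ext (2 ^ L) (fun j => colnorm p r M j * ind (D < colnorm p r M j))
    (fun j => sumR r (fun i => ind (D < colnorm p r M j) * rpow (Rabs (M i j)) p)))
    by (intros; rewrite sumR_scal; unfold colnorm; ring).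
  rewrite sumR_swap, <- sumR_plus. apply sumR_le; intros i _.
  assert (Hq : 0 <= p / 2 <= 1) by lra.
  rewrite (sumR_ext (2 ^ L) (fun j => M i j * M i j)
    (fun j => ind (~ D < colnorm p r M j) * (M i j * M i j)
            + ind (D < colnorm p r M j) * (M i j * M i j))).
  - rewrite sumR_plus.
    eapply Rle_trans; [apply rpow_subadd; [assumption| |]|].
    1, 2: apply sumR_nonneg; intros j _; apply Rmult_le_pos; [apply ind_bounds|nra].
    apply Rplus_le_compat_l.
    eapply Rle_trans; [apply rpow_subadd_sumR; [assumption|]|].
    + intros j _; apply Rmult_le_pos; [apply ind_bounds|nra].
    + apply sumR_le; intros j _. destruct (classic (D < colnorm p r M j)) as [H|H].
      * rewrite ind_true, !Rmult_1_l by assumption. right; symmetry; apply rpow_abs_sqr.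
      * rewrite ind_false, !Rmult_0_l by assumption. rewrite rpow_0; lra.
  - intros j _. destruct (classic (D < colnorm p r M j)) as [H|H].
    + rewrite (ind_true (D < _)), (ind_false (~ _)) by tauto. ring.
    + rewrite (ind_false (D < _)), (ind_true (~ _)) by tauto. ring.
Qed.
(** * The hard distribution of matrices *)

Definition truncate (N : nat) (v : nat -> R) (i : nat) : R :=
  if (i <? N)%nat then v i else 0.

Lemma sumR_truncate N n v p : (N <= n)%nat ->
  sumR n (fun i => rpow (Rabs (truncate N v i)) p) = sumR N (fun i => rpow (Rabs (v i)) p).
Proof.
  intros HN. rewrite (sumR_extend N) by (assumption ||
    (intros i Hi; unfold truncate; destruct (Nat.ltb_spec i N);
     [lia|rewrite Rabs_R0; apply rpow_0; lra])).
  apply sumR_ext; intros i Hi. unfold truncate.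
  destruct (Nat.ltb_spec i N); [reflexivity|lia].
Qed.

Lemma matvec_truncate N n M v i : (N <= n)%nat ->
  matvec n M (truncate N v) i = matvec N M v i.
Proof.
  intros HN. unfold matvec. rewrite (sumR_extend N) by (assumption ||
    (intros j Hj; unfold truncate; destruct (Nat.ltb_spec j N); [lia|lra])).
  apply sumR_ext; intros j Hj. unfold truncate.
  destruct (Nat.ltb_spec j N); [reflexivity|lia].
Qed.

Definition testmx (N : nat) (e : nat -> bool) (X : nat -> nat -> R) (i j : nat) : R :=
  match j with
  | O => truncate N (fun i => sgn (e i)) i
  | S k => truncate N (X k) i
  end.

Definition dtestmx (L k : nat) : list (R * ((nat -> bool) * (nat -> nat -> R))) :=
  dbind (diid true dsign (2 ^ L)) (fun e =>
    dbind (diid (fun _ => 0) (dcolumn L) k) (fun X => dret (e, X))).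

Lemma law_dtestmx L k : law (dtestmx L k).
Proof.
  apply law_dbind; [apply law_diid, law_dsign|]. intros e.
  apply law_dbind; [apply law_diid, law_dcolumn|]. intros X; apply law_dret.
Qed.

Lemma ev_dtestmx L k f :
  ev (dtestmx L k) f
  = ev (diid true dsign (2 ^ L)) (fun e => ev (diid (fun _ => 0) (dcolumn L) k) (fun X => f (e, X))).
Proof.
  unfold dtestmx. rewrite ev_dbind. apply ev_ext; intros e. rewrite ev_dbind.
  apply ev_ext; intros X. now rewrite ev_dret.
Qed.

Lemma ind_prodR_le k (Q : Prop) (h : nat -> Prop) :
  (Q -> forall i, (i < k)%nat -> h i) -> ind Q <= prodR k (fun i => ind (h i)).
Proof.
  intros H. destruct (classic Q) as [q|nq].
  - rewrite ind_true by assumption. specialize (H q).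
    induction k as [|k IH]; simpl; [lra|].
    rewrite (ind_true (h k)) by (apply H; lia). rewrite Rmult_1_r. apply IH; auto.
  - rewrite ind_false by assumption. clear. induction k as [|k IH]; simpl; [lra|].
    apply Rmult_le_pos; [assumption|apply ind_bounds].
Qed.

(** Read as [(1 - g)^n <= 1 / (1 + n g)]: if [n] independent columns are all good with probability
    near 1, each is bad with probability [O(1/n)]. *)
Lemma pow_complement_le g n : 0 <= g <= 1 -> (1 - g) ^ n * (1 + INR n * g) <= 1.
Proof.
  intros Hg. induction n as [|n IH]; [simpl; lra|].
  rewrite S_INR; simpl. assert (0 <= (1 - g) ^ n) by (apply pow_le; lra).
  assert (0 <= INR n) by apply pos_INR.
  apply Rle_trans with ((1 - g) ^ n * (1 + INR n * g)); [|assumption].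
  rewrite (Rmult_comm (1 - g)), Rmult_assoc. apply Rmult_le_compat_l; [assumption|].
  nra.
Qed.

(** The easy half of Khintchine's inequality in each row: Jensen with exponent [p/2] applied to the
    second moment of a sign sum. *)
Lemma ev_sign_image p r N M : 1 <= p < 2 ->
  ev (diid true dsign N) (fun e =>
    sumR r (fun i => rpow (Rabs (matvec N M (fun j => sgn (e j)) i)) p))
  <= sumR r (fun i => rpow (sumR N (fun j => M i j * M i j)) (p / 2)).
Proof.
  intros Hp. rewrite ev_sumR. apply sumR_le; intros i _.
  assert (E := ev_signs_sqr N 0 (fun j => M i j)). cbv beta in E.
  rewrite Rmult_0_l, Rplus_0_l in E. rewrite <- E.
  rewrite (ev_ext _ (fun e => rpow (Rabs (matvec N M (fun j => sgn (e j)) i)) p)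
    (fun e => rpow ((0 + sumR N (fun j => M i j * sgn (e j)))
                    * (0 + sumR N (fun j => M i j * sgn (e j)))) (p / 2))).
  - apply jensen; [apply law_diid, law_dsign|lra|]. intros e; nra.
  - intros e. rewrite rpow_abs_sqr. unfold matvec. now rewrite Rplus_0_l.
Qed.

(** The good event depends on the matrix, so one is chosen for each test matrix; as 0.98 < 0.99,
    [averaging] finds an outcome in most of them. Basis vectors then isolate the columns. *)
Lemma good_embedding {W : Type} (F : (W -> Prop) -> Prop) P p n d r Pi kappa L :
  1 <= p -> (2 ^ L <= n)%nat -> prob_space F P -> lp_OSE F P p n (S d) r Pi kappa ->
  exists (M : nat -> nat -> R) (h : (nat -> bool) * (nat -> nat -> R) -> Prop),
    98 / 100 < ev (dtestmx L d) (fun eX => ind (h eX)) /\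
    forall e X, h (e, X) ->
      2 ^ L <= sumR r (fun i => rpow (Rabs (matvec (2 ^ L) M (fun j => sgn (e j)) i)) p) /\
      forall k, (k < d)%nat -> dilates_le p (rpow kappa p) r (2 ^ L) M (X k).
Proof.
  intros Hp HN HP [Hk HO].
  pose (A := fun eX : (nat -> bool) * (nat -> nat -> R) => testmx (2 ^ L) (fst eX) (snd eX)).
  pose (pick := fun eX => constructive_indefinite_description _ (HO (A eX))).
  pose (h := fun eX => proj1_sig (pick eX)).
  assert (Hh : forall eX, F (h eX) /\ P (h eX) >= 0.99 /\ forall w, h eX w -> forall x,
     lpnorm p n (matvec (S d) (A eX) x) <= lpnorm p r (matvec n (Pi w) (matvec (S d) (A eX) x))
     /\ lpnorm p r (matvec n (Pi w) (matvec (S d) (A eX) x))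
        <= kappa * lpnorm p n (matvec (S d) (A eX) x)).
  { intros eX; exact (proj2_sig (pick eX)). }
  destruct (averaging F P h (dtestmx L d) (99 / 100) (98 / 100) HP (law_dtestmx L d)
    (fun eX => proj1 (Hh eX))) as [w Hw]; [|lra|].
  { intros eX. assert (H := proj1 (proj2 (Hh eX))). lra. }
  exists (Pi w), (fun eX => h eX w). split; [exact Hw|].
  intros e X HeX. assert (G := proj2 (proj2 (Hh (e, X))) w HeX). clear - G Hk Hp HN.
  assert (C : forall k, (k < S d)%nat ->
    matvec (S d) (A (e, X)) (fun j => if Nat.eq_dec j k then 1 else 0)
    = truncate (2 ^ L) (match k with O => fun i => sgn (e i) | S k' => X k' end)).
  { intros k Hkd. apply functional_extensionality; intros i.
    rewrite matvec_basis by assumption. now destruct k. }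
  assert (T : forall v, (fun i => rpow (Rabs (matvec n (Pi w) (truncate (2 ^ L) v) i)) p)
    = (fun i => rpow (Rabs (matvec (2 ^ L) (Pi w) v i)) p)).
  { intros v; apply functional_extensionality; intros i. now rewrite matvec_truncate. }
  split.
  - destruct (G (fun j => if Nat.eq_dec j 0 then 1 else 0)) as [H _].
    rewrite C in H by lia. rewrite <- (Rmult_1_l (lpnorm p r _)) in H.
    apply lpnorm_le in H; [|lra|lra].
    rewrite rpow_1_l, Rmult_1_l, sumR_truncate, T in H by assumption.
    rewrite (sumR_ext (2 ^ L) _ (fun _ => 1)) in H
      by (intros; rewrite Rabs_sgn; apply rpow_1_l).
    rewrite sumR_const, pow_INR, Rmult_1_r in H. exact H.
  - intros k Hkd. destruct (G (fun j => if Nat.eq_dec j (S k) then 1 else 0)) as [_ H].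
    rewrite C in H by lia. apply lpnorm_le in H; [|lra|lra].
    rewrite sumR_truncate, T in H by assumption. exact H.
Qed.

Lemma distortion_core {W : Type} (F : (W -> Prop) -> Prop) P p n d r Pi kappa L :
  1 <= p < 2 -> (1 <= d)%nat -> (0 < r)%nat -> (2 ^ L <= n)%nat ->
  prob_space F P -> lp_OSE F P p n d r Pi kappa ->
  49 / 100 <= rpow kappa p *
    (rpow (INR r / 2 ^ L) (1 - p / 2) + INR (S L) * INR (S L) / INR d).
Proof.
  intros Hp Hd Hr HN HP HO. assert (Hk := proj1 HO).
  set (K := rpow kappa p).
  assert (HK : 1 <= K) by (unfold K; rewrite <- (rpow_1_l p); apply rpow_le; lra).
  assert (Rd : 1 <= INR d) by (apply (le_INR 1); assumption).
  assert (RL : 1 <= INR (S L)) by (apply (le_INR 1); lia).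
  set (b := rpow (INR r / 2 ^ L) (1 - p / 2)). assert (Hb : 0 <= b) by apply rpow_nonneg.
  assert (Hid : 0 < / INR d) by (apply Rinv_0_lt_compat; lra).
  assert (Triv : 49 / 100 <= INR (S L) * INR (S L) / INR d ->
    49 / 100 <= K * (b + INR (S L) * INR (S L) / INR d)) by (intros; nra).
  (* The [d - 1] sparse columns are all good with probability at least 0.98, so each is bad with
     probability at most [1 / (49 (d - 1))], which is below [eta] for [d >= 2]. *)
  set (eta := 5 / 100 / INR d).
  (* For [d = 1] there is no sparse column, but [(L + 1)^2 / d >= 1] gives the claim. *)
  destruct (Nat.eq_dec d 1) as [->|Hd1].
  { apply Triv. simpl (INR 1). nra. }
  (* In this case [(L + 1) / d > 5/2], and the second term again suffices. *)
  destruct (Rlt_dec (1 / 8) (INR (S L) * eta)) as [Hbig|Heta].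
  { apply Triv. unfold eta in Hbig.
    replace (INR (S L) * INR (S L) / INR d)
      with (INR (S L) * (INR (S L) * (5 / 100 / INR d)) * 20) by (field; lra).
    nra. }
  apply Rnot_lt_le in Heta. clear Triv.
  destruct d as [|d]; [lia|].
  destruct (good_embedding F P p n d r Pi kappa L ltac:(lra) HN HP HO) as [M [h [Hav Hh]]].
  rewrite ev_dtestmx in Hav. fold K in Hh.
  assert (H2L : 0 < 2 ^ L) by (apply pow_lt; lra).
  set (N := (2 ^ L)%nat) in *.
  pose (Q := fun e : nat -> bool =>
    sumR r (fun i => rpow (Rabs (matvec N M (fun j => sgn (e j)) i)) p)).
  assert (HQ : forall e, 0 <= Q e)
    by (intros; apply sumR_nonneg; intros; apply rpow_nonneg).
  assert (law_e : law (diid true dsign N)) by apply law_diid, law_dsign.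
  assert (law_X : law (diid (fun _ => 0) (dcolumn L) d)) by apply law_diid, law_dcolumn.
  (* [Q e] is at least [2^L] on good test matrices and nonnegative on the others, so its mean is at
     least 0.98 times [2^L]. *)
  assert (Hlow : 98 / 100 * 2 ^ L
    <= sumR r (fun i => rpow (sumR N (fun j => M i j * M i j)) (p / 2))).
  { eapply Rle_trans; [|apply ev_sign_image; assumption]. fold Q.
    apply Rle_trans with (2 ^ L * ev (diid true dsign N) (fun e =>
      ev (diid (fun _ => 0) (dcolumn L) d) (fun X => ind (h (e, X))))); [nra|].
    rewrite <- ev_scal. apply ev_le; [assumption|]. intros e.
    rewrite <- (ev_const (diid (fun _ => 0) (dcolumn L) d) (Q e)) by assumption.
    rewrite <- ev_scal. apply ev_le; [assumption|]. intros X.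
    destruct (classic (h (e, X))) as [H|H].
    - rewrite ind_true by assumption. destruct (Hh e X H) as [H1 _]. fold (Q e) in H1. lra.
    - rewrite ind_false by assumption. specialize (HQ e). lra. }
  pose (g := ev (dcolumn L) (fun X => ind (~ dilates_le p K r N M X))).
  assert (Hg0 : 0 <= g) by (apply ev_nonneg; [apply law_dcolumn|intros; apply ind_bounds]).
  assert (Hf : ev (dcolumn L) (fun X => ind (dilates_le p K r N M X)) = 1 - g).
  { assert (E : ev (dcolumn L) (fun X => ind (dilates_le p K r N M X)) + g = 1).
    { unfold g; rewrite <- ev_plus. rewrite <- (ev_const (dcolumn L) 1) by apply law_dcolumn.
      apply ev_ext; intros X. destruct (classic (dilates_le p K r N M X)).
      - rewrite ind_true, ind_false by tauto; lra.
      - rewrite ind_false, ind_true by tauto; lra. }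
    lra. }
  assert (Hg1 : g <= 1).
  { assert (0 <= ev (dcolumn L) (fun X => ind (dilates_le p K r N M X)))
      by (apply ev_nonneg; [apply law_dcolumn|intros; apply ind_bounds]). lra. }
  (* Goodness bounds the dilation of all sparse columns at once, and these are independent. *)
  assert (Hpow : 98 / 100 <= (1 - g) ^ d).
  { rewrite <- Hf, <- (ev_diid_prod (fun _ => 0)).
    rewrite <- (ev_const (diid true dsign N)) by assumption.
    eapply Rle_trans; [left; exact Hav|]. rewrite ev_const by assumption.
    rewrite <- (ev_const (diid true dsign N)) by assumption.
    apply ev_le; [assumption|]. intros e. apply ev_le; [assumption|]. intros X.
    apply ind_prodR_le. intros H. exact (proj2 (Hh e X H)). }
  assert (Hgeta : g <= eta).
  { assert (H := pow_complement_le g d ltac:(lra)).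
    assert (Hd2 : 1 <= INR d) by (apply (le_INR 1); lia).
    assert (H1 : 98 / 100 * (1 + INR d * g) <= 1).
    { eapply Rle_trans; [|exact H]. apply Rmult_le_compat_r; [nra|assumption]. }
    unfold eta. apply Rmult_le_reg_r with (INR (S d)); [lra|].
    replace (5 / 100 / INR (S d) * INR (S d)) with (5 / 100) by (field; lra).
    rewrite S_INR. nra. }
  assert (HC := matrix_core p K r L M eta Hp Hr ltac:(lra) Hgeta Heta).
  fold N b in HC. assert (HC2 := Rle_trans _ _ _ Hlow HC).
  unfold eta in HC2.
  set (a := INR (S L) * INR (S L) / INR (S d)).
  replace (8 * (INR (S L) * INR (S L)) * (5 / 100 / INR (S d))) with (4 / 10 * a) in HC2
    by (unfold a; field; lra).
  assert (Ha : 0 <= a) by (apply Rle_mult_inv_pos; nra).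
  assert (HC3 : 98 / 100 <= 2 * K * (b + 4 / 10 * a)).
  { apply Rmult_le_reg_r with (2 ^ L); [assumption|]. lra. }
  nra.
Qed.

(** * Choice of the ambient dimension *)

(** [log2 r + 1 <= 2 log2 r <= 2 ln r / ln 2], and [ln 2 > 1/2]. *)
Lemma log2_le_ln r : (2 <= r)%nat -> INR (S (Nat.log2 r)) <= 4 * ln (INR r).
Proof.
  intros Hr. destruct (Nat.log2_spec r ltac:(lia)) as [H1 _].
  assert (Hl : (1 <= Nat.log2 r)%nat) by (apply (Nat.log2_le_mono 2); assumption).
  apply le_INR in H1. rewrite pow_INR in H1. simpl (INR 2) in H1.
  assert (H2 : INR (Nat.log2 r) * ln 2 <= ln (INR r)).
  { rewrite <- ln_pow by lra. replace 2 with (1 + 1) by lra.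
    destruct H1 as [H1|<-]; [|right; reflexivity].
    left; apply ln_increasing; [apply pow_lt; lra|assumption]. }
  assert (H3 := ln_lt_2). apply (le_INR 1) in Hl. simpl (INR 1) in Hl.
  rewrite S_INR. nra.
Qed.

(** [L] is the smaller of [log2 n] and [(n0 + 1) (log2 r + 1)]. In the second case
    [2^L >= r^(n0+1)], so the left side is at most [r^(-n0 q) <= 1/r <= 1/d]; in the first
    [2^L >= n/2], which costs a factor [2^q <= 2]. *)
Lemma ambient_dimension q n0 : 0 < q <= 1 -> 1 <= INR n0 * q ->
  forall n d r : nat, (1 <= d)%nat -> (d <= n)%nat -> (d <= r)%nat -> (2 <= r)%nat ->
  exists L : nat, (2 ^ L <= n)%nat /\ INR (S L) <= 8 * INR (S n0) * ln (INR r) /\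
    rpow (INR r / 2 ^ L) q <= 1 / INR d + 2 * rpow (INR r / INR n) q.
Proof.
  intros Hq Hn0 n d r Hd Hdn Hdr Hr.
  assert (Rd : 1 <= INR d) by (apply (le_INR 1); assumption).
  assert (Rn : INR d <= INR n) by now apply le_INR.
  assert (Rr : INR d <= INR r) by now apply le_INR.
  assert (Hb : 0 < rpow (INR r / INR n) q)
    by (apply rpow_pos, Rdiv_lt_0_compat; lra).
  assert (Hid : 0 < 1 / INR d) by (apply Rdiv_lt_0_compat; lra).
  set (l := S (Nat.log2 r)).
  destruct (Nat.log2_spec n ltac:(lia)) as [N1 N2].
  destruct (Nat.log2_spec r ltac:(lia)) as [_ R2]. fold l in R2.
  assert (HL : forall L, (L <= S n0 * l)%nat -> INR (S L) <= 8 * INR (S n0) * ln (INR r)).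
  { intros L HL. assert (H := log2_le_ln r Hr). fold l in H.
    apply le_INR in HL. rewrite mult_INR in HL.
    assert (1 <= INR (S n0)) by (apply (le_INR 1); lia).
    assert (1 <= INR l) by (apply (le_INR 1); unfold l; lia).
    rewrite (S_INR L). nra. }
  destruct (le_lt_dec (S n0 * l) (Nat.log2 n)) as [Hc|Hc].
  - exists (S n0 * l)%nat. split; [|split; [now apply HL|]].
    + eapply Nat.le_trans; [|exact N1]. apply Nat.pow_le_mono_r; lia.
    + apply Rle_trans with (1 / INR d); [|lra].
      apply Nat.lt_le_incl, le_INR in R2. rewrite pow_INR in R2. simpl (INR 2) in R2.
      replace (1 + 1) with 2 in R2 by lra.
      assert (Hrn : 0 < INR r ^ n0) by (apply pow_lt; lra).
      assert (H1 : INR r / 2 ^ (S n0 * l) <= / INR r ^ n0).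
      { apply Rle_trans with (INR r / INR r ^ S n0).
        - unfold Rdiv. apply Rmult_le_compat_l; [lra|].
          apply Rinv_le_contravar; [apply pow_lt; lra|].
          rewrite Nat.mul_comm, pow_mult. apply pow_incr; lra.
        - right; simpl; field; lra. }
      eapply Rle_trans; [apply rpow_le; [|exact H1]; lra|].
      rewrite rpow_Rinv by assumption. unfold Rdiv; rewrite Rmult_1_l.
      apply Rinv_le_contravar; [lra|].
      apply Rle_trans with (INR r); [assumption|].
      rewrite rpow_Rpower, <- Rpower_pow, Rpower_mult by lra.
      rewrite <- (Rpower_1 (INR r)) at 1 by lra.
      apply Rle_Rpower; lra.
  - exists (Nat.log2 n). split; [assumption|split; [apply HL; lia|]].
    apply Rle_trans with (2 * rpow (INR r / INR n) q); [|lra].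
    apply Nat.lt_le_incl, le_INR in N2. rewrite pow_INR in N2. simpl (INR 2) in N2.
    replace (1 + 1) with 2 in N2 by lra. simpl in N2.
    set (y := 2 ^ Nat.log2 n) in *. assert (0 < y) by (apply pow_lt; lra).
    apply Rle_trans with (rpow (2 * (INR r / INR n)) q).
    + apply rpow_le; [lra|].
      replace (2 * (INR r / INR n)) with (INR r * (2 / INR n)) by (field; lra).
      unfold Rdiv at 1. apply Rmult_le_compat_l; [lra|].
      replace (2 / INR n) with (/ (INR n / 2)) by (field; lra).
      apply Rinv_le_contravar; lra.
    + rewrite rpow_mult by (lra || (left; apply Rdiv_lt_0_compat; lra)).
      apply Rmult_le_compat_r; [lra|].
      rewrite rpow_Rpower by lra. rewrite <- (Rpower_1 2) at 2 by lra.
      apply Rle_Rpower; lra.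
Qed.

(** * Assembling the lower bound on the distortion *)

Theorem theorem1 :
  forall p : R, 1 <= p < 2 ->
  exists c : R, 0 < c /\
  forall (n d r : nat), (1 <= d)%nat -> (d <= n)%nat -> (2 <= r)%nat ->
  forall (Omega : Type) (F : (Omega -> Prop) -> Prop) (P : (Omega -> Prop) -> R)
         (Pi : Omega -> nat -> nat -> R) (kappa : R),
    prob_space F P ->
    random_matrix F r n Pi ->
    lp_OSE F P p n d r Pi kappa ->
    kappa >= c / (rpow (1 / INR d) (1 / p) * rpow (ln (INR r)) (2 / p)
                  + rpow (INR r / INR n) (1 / p - 1 / 2)).
Proof.
  intros p Hp. set (q := 1 - p / 2). assert (Hq : 0 < q <= 1) by (unfold q; lra).
  (* [n0] depends on [p] only, as the final constant must. *)
  destruct (INR_unbounded (1 / q)) as [n0 Hn0].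
  assert (Hn0q : 1 <= INR n0 * q).
  { apply Rlt_le, (Rmult_le_compat_r q) in Hn0; [|lra].
    unfold Rdiv in Hn0. rewrite Rmult_assoc, Rinv_l in Hn0; lra. }
  set (k := INR (S n0)). assert (Hk : 1 <= k) by (apply (le_INR 1); lia).
  (* 0.49 comes from [distortion_core]; 128 is twice the square of the 8 in the bound on [L + 1]. *)
  set (c0 := 49 / 100 / (128 * (k * k))).
  assert (Hc0 : 0 < c0) by (apply Rdiv_lt_0_compat; nra).
  exists (rpow c0 (1 / p)). split; [now apply rpow_pos|].
  intros n d r Hd Hdn Hr Omega F P Pi kappa HP _ HO.
  assert (Hkappa := proj1 HO).
  assert (Hdr := embedding_rank F P p n d r Pi kappa (proj1 Hp) Hdn HP HO).
  destruct (ambient_dimension q n0 Hq Hn0q n d r Hd Hdn Hdr Hr) as [L [HN [HL Hb]]].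
  assert (Hcore := distortion_core F P p n d r Pi kappa L Hp Hd ltac:(lia) HN HP HO).
  fold q in Hcore. fold k in HL.
  assert (Rd : 1 <= INR d) by (apply (le_INR 1); assumption).
  assert (Rn : INR d <= INR n) by now apply le_INR.
  assert (Rr : 2 <= INR r) by (apply (le_INR 2); assumption).
  assert (Hln : 0 < ln (INR r)) by (rewrite <- ln_1; apply ln_increasing; lra).
  set (x := ln (INR r)) in *.
  set (K := rpow kappa p) in *. assert (HK : 0 <= K) by apply rpow_nonneg.
  set (b := rpow (INR r / INR n) q) in *.
  assert (Hb0 : 0 < b) by (apply rpow_pos, Rdiv_lt_0_compat; lra).
  set (a := 1 / INR d * (x * x)).
  assert (Hid : 0 < 1 / INR d) by (apply Rdiv_lt_0_compat; lra).
  assert (Ha : 0 < a) by (apply Rmult_lt_0_compat; nra).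
  assert (Hmain : c0 <= K * (a + b)).
  { assert (RL : 1 <= INR (S L)) by (apply (le_INR 1); lia).
    set (s := INR (S L)) in *.
    assert (Hs : s * s <= 64 * (k * k) * (x * x)).
    { replace (64 * (k * k) * (x * x)) with ((8 * k * x) * (8 * k * x)) by ring.
      apply Rmult_le_compat; lra. }
    assert (Hsd : s * s / INR d <= 64 * (k * k) * a).
    { unfold a. replace (64 * (k * k) * (1 / INR d * (x * x)))
        with (64 * (k * k) * (x * x) * (1 / INR d)) by ring.
      replace (s * s / INR d) with (s * s * (1 / INR d)) by (field; lra).
      apply Rmult_le_compat_r; lra. }
    (* The extra [1/d] is absorbed by a second copy of the logarithmic term: hence twice 64. *)
    assert (H1d : 1 / INR d <= s * s / INR d)
      by (unfold Rdiv; apply Rmult_le_compat_r; [left; apply Rinv_0_lt_compat; lra|nra]).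
    assert (H : rpow (INR r / 2 ^ L) q + s * s / INR d <= 128 * (k * k) * (a + b)).
    { assert (1 <= k * k) by nra. assert (b <= k * k * b) by nra. lra. }
    apply (Rmult_le_compat_l K) in H; [|assumption].
    unfold c0. apply Rmult_le_reg_r with (128 * (k * k)); [nra|].
    replace (49 / 100 / (128 * (k * k)) * (128 * (k * k))) with (49 / 100) by (field; lra).
    lra. }
  assert (Hip : 0 <= 1 / p <= 1).
  { split; [apply Rle_mult_inv_pos; lra|].
    apply Rmult_le_reg_r with p; [lra|]. unfold Rdiv; rewrite Rmult_assoc, Rinv_l; lra. }
  (* The [p]-th root turns [K] into [kappa]; subadditivity splits the root of [a + b], and
     [q / p = 1/p - 1/2]. *)
  apply rpow_le with (a := 1 / p) in Hmain; [|lra].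
  rewrite rpow_mult in Hmain by lra. unfold K in Hmain.
  rewrite rpow_rpow in Hmain. replace (p * (1 / p)) with 1 in Hmain by (field; lra).
  rewrite rpow_1_r in Hmain by lra.
  assert (Hsub := rpow_subadd a b (1 / p) Hip ltac:(lra) ltac:(lra)).
  assert (Ea : rpow a (1 / p) = rpow (1 / INR d) (1 / p) * rpow x (2 / p)).
  { unfold a. rewrite rpow_mult by nra. f_equal. rewrite rpow_mult, <- rpow_plus by lra.
    f_equal; field; lra. }
  assert (Eb : rpow b (1 / p) = rpow (INR r / INR n) (1 / p - 1 / 2)).
  { unfold b; rewrite rpow_rpow. f_equal. unfold q; field; lra. }
  rewrite <- Ea, <- Eb.
  assert (Pa := rpow_pos a (1 / p) Ha). assert (Pb := rpow_pos b (1 / p) Hb0).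
  apply Rle_ge. apply Rmult_le_reg_r with (rpow a (1 / p) + rpow b (1 / p)); [lra|].
  unfold Rdiv. rewrite Rmult_assoc, Rinv_l, Rmult_1_r by lra.
  eapply Rle_trans; [exact Hmain|]. apply Rmult_le_compat_l; lra.
Qed.
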